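(* For any $PF$-algebra $A\in\mathcal{V}$ such that $K(A)$ is closed under the commutator operation, the following are equivalent: (1) $A$ is a $PP$-algebra; (2) the reticulation $L(A)$ is a Stone lattice; (3) the inclusion $Min_{Id,Z}(L(A))\subseteq Spec_{Id,Z}(L(A))$ has a continuous retraction; (4) the inclusion $Min_Z(A)\subseteq Spec_Z(A)$ has a continuous retraction; (5) $Min_Z(A)$ is a compact space.
   Context: $\mathcal{V}$ is a fixed congruence-modular variety of algebras (of a finite signature) that is semidegenerate: no nontrivial algebra in $\mathcal{V}$ has one-element subalgebras (equivalently, $\nabla_A$ is compact in $Con(A)$ for every $A\in\mathcal{V}$). For $A\in\mathcal{V}$, $Con(A)$ is the complete lattice of congruences of $A$, with least element $\Delta_A$ and greatest element $\nabla_A$; $K(A)$ is the set of compact (= finitely generated) congruences and $PCon(A)$ the set of principal congruences. $B(Con(A))$ is the set of complemented elements of $Con(A)$. Commutator: $[\cdot,\cdot]=[\cdot,\cdot]_A$ is the (modular) commutator, i.e. the greatest operation on the congruence lattices of members of $\mathcal{V}$ such that for every surjective morphism $f:A\to B$ in $\mathcal{V}$ and all $\alpha,\beta\in Con(A)$: $[\alpha,\beta]_A\subseteq\alpha\cap\beta$ and $[\alpha,\beta]_A\vee Ker(f)=f^{-1}([f(\alpha\vee Ker(f)),f(\beta\vee Ker(f))]_B)$. Put $\alpha^{\perp}=\bigvee\{\gamma\in Con(A)\mid[\alpha,\gamma]=\Delta_A\}$. $\phi\in Con(A)\setminus\{\nabla_A\}$ is prime if $[\alpha,\beta]\subseteq\phi$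 implies $\alpha\subseteq\phi$ or $\beta\subseteq\phi$ (for $\alpha,\beta\in Con(A)$); $Spec(A)$ is the set of prime congruences; $\rho(\theta)=\bigcap\{\phi\in Spec(A)\mid\theta\subseteq\phi\}$. $Spec_Z(A)$ is $Spec(A)$ with the Zariski topology, whose open sets are $D(\theta)=\{\phi\in Spec(A)\mid\theta\not\subseteq\phi\}$, $\theta\in Con(A)$; $Min_Z(A)$ is the set of minimal prime congruences with the induced topology. Reticulation: when $K(A)$ is closed under the commutator, $L(A)=K(A)/{\equiv}$ where $\alpha\equiv\beta$ iff $\rho(\alpha)=\rho(\beta)$; $\lambda_A:K(A)\to L(A)$ is the quotient map; $L(A)$ is a bounded distributive lattice with $\lambda_A(\alpha)\vee\lambda_A(\beta)=\lambda_A(\alpha\vee\beta)$, $\lambda_A(\alpha)\wedge\lambda_A(\beta)=\lambda_A([\alpha,\beta])$, $0=\lambda_A(\Delta_A)$, $1=\lambda_A(\nabla_A)$. A congruence $\theta$ is pure if for every $\alpha\in K(A)$ with $\alpha\subseteq\theta$ one has $\theta\vee\alpha^{\perp}=\nabla_A$; $A$ is a $PF$-algebra if $\alpha^{\perp}$ is pure for all $\alpha\in PCon(A)$; $A$ is a $PP$-algebra if $\alpha^{\perp}\in B(Con(A))$ for every $\alpha\in PCon(A)$. For a bounded distributive lattice $L$: $B(L)$ is the set of complemented elements, $(e]=\{y\in L\mid y\leq e\}$, $Ann(x)=\{y\in L\mid x\wedge y=0\}$; $L$ is a Stone lattice if for each $x\in L$ there is $e\in B(L)$ with $Ann(x)=(e]$.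 $Spec_{Id,Z}(L)$ is the set of prime ideals of $L$ with the Stone topology (basis $\{Q\mid x\notin Q\}$, $x\in L$), and $Min_{Id,Z}(L)$ is its subspace of minimal prime ideals. *)

(* Defs.v *)
From HB Require Import structures.
From mathcomp Require Import all_boot all_order generic_quotient.
From mathcomp Require Import all_classical topology.

Set Implicit Arguments.
Unset Strict Implicit.
Unset Printing Implicit Defensive.

Import Order.TTheory.
Local Open Scope classical_set_scope.
Local Open Scope order_scope.
Local Open Scope quotient_scope.

(* Universe pitfall: quantifiers over all members of a variety live one
   universe above the carriers, so they must not go through [set], [image]...
   of the library; plain predicates are used for them. *)

Record signature := Signature { symb : finType; arity : symb -> nat }.

Record algebra (S : signature) := Algebra {
  carrier :> Type;
  op : forall o : symb S, ('I_(arity o) -> carrier) -> carrier;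
  carrier_inhabited : inhabited carrier }.

Inductive term (S : signature) :=
| TVar (n : nat)
| TApp (o : symb S) (ts : 'I_(arity o) -> term S).

Fixpoint eval (S : signature) (A : algebra S) (v : nat -> A) (t : term S) : A :=
  match t with
  | TVar n => v n
  | TApp o ts => op (fun i => eval v (ts i))
  end.

(* A variety is given by a set of identities. *)
Definition variety (S : signature) := set (term S * term S).

Definition satisfies (S : signature) (V : variety S) (A : algebra S) :=
  forall e, V e -> forall v : nat -> A, eval v e.1 = eval v e.2.

Record member (S : signature) (V : variety S) := Member {
  member_algebra :> algebra S;
  member_satisfies : satisfies V member_algebra }.

Record hom (S : signature) (A B : algebra S) := Hom {
  hom_fun :> A -> B;
  homP : forall (o : symb S) (t : 'I_(arity o) -> A),
    hom_fun (op t) = op (fun i => hom_fun (t i)) }.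

Definition subuniverse (S : signature) (A : algebra S) (X : set A) :=
  forall (o : symb S) (t : 'I_(arity o) -> A), (forall i, X (t i)) -> X (op t).

Definition semidegenerate (S : signature) (V : variety S) :=
  forall A : member V, (exists x y : A, x <> y) ->
    ~ exists x : A, subuniverse [set x].

Record con (S : signature) (A : algebra S) := Con {
  con_rel :> A -> A -> Prop;
  con_refl : forall x, con_rel x x;
  con_sym : forall x y, con_rel x y -> con_rel y x;
  con_trans : forall x y z, con_rel x y -> con_rel y z -> con_rel x z;
  con_op : forall (o : symb S) (t u : 'I_(arity o) -> A),
    (forall i, con_rel (t i) (u i)) -> con_rel (op t) (op u) }.

HB.instance Definition _ (S : signature) (A : algebra S) :=
  gen_eqMixin (con A).
HB.instance Definition _ (S : signature) (A : algebra S) :=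
  gen_choiceMixin (con A).

Section Congruences.
Variables (S : signature) (A : algebra S).
Implicit Types (a b c : con A) (R : set (A * A)).

Lemma con_ext a b : (forall x y, a x y <-> b x y) -> a = b.
Proof.
case: a b => [a ? ? ? ?] [b ? ? ? ?] /= ab.
have {}ab : a = b by apply/funext => x; apply/funext => y; apply/propext/ab.
by subst b; congr Con; exact: Prop_irrelevance.
Qed.

Definition con_inf (X : set (con A)) : con A.
Proof.
refine (@Con S A (fun x y => forall a, X a -> a x y) _ _ _ _).
- by move=> x a _; exact: con_refl.
- by move=> x y xy a Xa; exact/con_sym/xy.
- by move=> x y z xy yz a Xa; exact: con_trans (xy _ Xa) (yz _ Xa).
- by move=> o t u tu a Xa; apply: con_op => i; exact: tu.
Defined.

(* The congruence generated by R. *)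
Definition cg R : con A :=
  con_inf [set a | forall p, R p -> a p.1 p.2].

Definition con_sup (X : set (con A)) : con A :=
  cg [set p | exists2 a, X a & a p.1 p.2].

Definition con_bot : con A.
Proof.
refine (@Con S A eq _ _ _ _) => //; first by move=> x y z -> ->.
by move=> o t u tu; congr op; exact/funext.
Defined.

Definition con_top : con A.
Proof. by refine (@Con S A (fun _ _ => True) _ _ _ _). Defined.

Definition con_le : rel (con A) :=
  fun a b => `[< forall x y, a x y -> b x y >].

Definition con_meet a b := con_inf [set c | c = a \/ c = b].
Definition con_join a b := con_sup [set c | c = a \/ c = b].

Fact con_le_refl : reflexive con_le.
Proof. by move=> a; apply/asboolP. Qed.

Fact con_le_anti : antisymmetric con_le.
Proof.
by move=> a b /andP[/asboolP ab /asboolP ba]; apply: con_ext => x y; split; auto.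
Qed.

Fact con_le_trans : transitive con_le.
Proof. by move=> b a c /asboolP ab /asboolP bc; apply/asboolP => x y /ab/bc. Qed.

Fact con_display : Order.disp_t. Proof. exact: Order.Disp tt tt. Qed.

HB.instance Definition _ :=
  Order.Le_isPOrder.Build con_display (con A)
    con_le_refl con_le_anti con_le_trans.

Lemma conleP a b : reflect (forall x y, a x y -> b x y) (a <= b).
Proof. exact: asboolP. Qed.

Lemma con_infP (X : set (con A)) c :
  c <= con_inf X <-> forall a, X a -> c <= a.
Proof.
split=> [/conleP cX a Xa|cX]; apply/conleP => x y.
  by move=> /cX; apply.
by move=> xy a /cX/conleP; apply.
Qed.

Lemma cgP R c : cg R <= c <-> forall p, R p -> c p.1 p.2.
Proof.
split=> [/conleP Rc p Rp|Rc]; last by apply/conleP => x y; apply.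
by apply: Rc => a; apply.
Qed.

Lemma con_supP (X : set (con A)) c :
  con_sup X <= c <-> forall a, X a -> a <= c.
Proof.
split=> [/cgP Xc a Xa|Xc].
  by apply/conleP => x y xy; apply: (Xc (x, y)); exists a.
by apply/cgP => p [a /Xc/conleP]; apply.
Qed.

Fact con_meetP a b c : (a <= con_meet b c) = (a <= b) && (a <= c).
Proof.
apply/idP/andP => [/con_infP h|[ab ac]]; first by split; apply: h; [left|right].
by apply/con_infP => d [->|->].
Qed.

Fact con_joinP a b c : (con_join a b <= c) = (a <= c) && (b <= c).
Proof.
apply/idP/andP => [/con_supP h|[ab ac]]; first by split; apply: h; [left|right].
by apply/con_supP => d [->|->].
Qed.

HB.instance Definition _ :=
  @Order.POrder_MeetJoin_isLattice.Build con_display (con A)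
    con_meet con_join con_meetP con_joinP.

Fact con_le0x a : con_bot <= a.
Proof. by apply/conleP => x y /= ->; exact: con_refl. Qed.

Fact con_lex1 a : a <= con_top.
Proof. exact/conleP. Qed.

HB.instance Definition _ :=
  Order.hasBottom.Build con_display (con A) con_le0x.
HB.instance Definition _ :=
  Order.hasTop.Build con_display (con A) con_lex1.

Definition principal a := exists x y : A, a = cg [set (x, y)].

(* In the algebraic lattice of congruences, compact means finitely
   generated. *)
Definition compact_con : set (con A) :=
  [set a | exists2 R : set (A * A), finite_set R & a = cg R].

End Congruences.

Definition congruence_modular (S : signature) (V : variety S) :=
  forall (A : member V) (a b c : con A),
    a <= c -> (a `|` b) `&` c = a `|` (b `&` c).

Section Morphisms.
Variables (S : signature) (A B : algebra S) (f : hom A B).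

Definition preim_con (b : con B) : con A.
Proof.
refine (@Con S A (fun x y => b (f x) (f y)) _ _ _ _).
- by move=> x; exact: con_refl.
- by move=> x y; exact: con_sym.
- by move=> x y z; exact: con_trans.
- by move=> o t u tu; rewrite !homP; exact: con_op.
Defined.

Definition ker_con : con A := preim_con \bot.

(* When f is surjective and ker_con <= a, the image of a is already a
   congruence (lemma img_conE), so that no new pair is generated. *)
Definition img_con (a : con A) : con B :=
  cg [set p | exists x y, a x y /\ p = (f x, f y)].

Lemma img_conE (a : con A) : (forall y, exists x, f x = y) -> ker_con <= a ->
  forall u v, img_con a u v <-> exists x y, [/\ a x y, f x = u & f y = v].
Proof.
move=> fsurj /conleP ka u v; split; last first.
  by move=> [x [y [xy <- <-]]] c cP; apply: (cP (f x, f y)); exists x, y.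
pose T u v := exists x y, [/\ a x y, f x = u & f y = v].
have Trefl x : T x x.
  by have [y <-] := fsurj x; exists y, y; split=> //; exact: con_refl.
have Tsym x y : T x y -> T y x.
  by move=> [s [t [st <- <-]]]; exists t, s; split=> //; exact: con_sym.
have Ttrans x y z : T x y -> T y z -> T x z.
  move=> [s [t [st <- <-]]] [s' [t' [st' ts' <-]]]; exists s, t'; split=> //.
  apply: (con_trans st); apply: (con_trans _ st').
  by apply: ka => /=; rewrite ts'.
have Top (o : symb S) (t t' : 'I_(arity o) -> B) :
    (forall i, T (t i) (t' i)) -> T (op t) (op t').
  move=> /boolp.choice[g /boolp.choice[h gh]]; exists (op g), (op h); split.
  - by apply: con_op => i; case: (gh i).
  - by rewrite homP; congr op; apply/funext => i; case: (gh i).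
  - by rewrite homP; congr op; apply/funext => i; case: (gh i).
move=> uv; apply: (uv (Con Trefl Tsym Ttrans Top)) => p /= [x [y [xy ->]]].
by exists x, y.
Qed.

End Morphisms.

Section Commutator.
Variables (S : signature) (V : variety S).

Definition commutator_axiom
    (C : forall A : member V, con A -> con A -> con A) :=
  forall (A B : member V) (f : hom A B), (forall y, exists x, f x = y) ->
  forall a b : con A,
    C A a b <= a `&` b /\
    C A a b `|` ker_con f =
      preim_con f (C B (img_con f (a `|` ker_con f))
                       (img_con f (b `|` ker_con f))).

(* The greatest operation satisfying commutator_axiom (see
   commutator_greatest), built as the join of all of them. *)
Definition commutator (A : member V) (a b : con A) : con A :=
  con_sup [set c | exists2 C, commutator_axiom C & c = C A a b].

Lemma commutator_le (A : member V) (a b : con A) : commutator a b <= a `&` b.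
Proof.
apply/con_supP => _ [C /(_ A A) CP ->].
have surj_id (y : A) : exists x : A, x = y by exists y.
by have [] := CP (@Hom S A A id (fun _ _ => erefl)) surj_id a b.
Qed.

Lemma commutator_ge C : commutator_axiom C ->
  forall (A : member V) (a b : con A), C A a b <= commutator a b.
Proof.
move=> CP A a b.
by apply: ((con_supP _ _).1 (lexx (commutator a b))); exists C.
Qed.

Lemma commutator_greatest :
  commutator_axiom commutator /\
  forall C, commutator_axiom C ->
    forall (A : member V) (a b : con A), C A a b <= commutator a b.
Proof.
split; last exact: commutator_ge.
move=> A B f fsurj a b; split; first exact: commutator_le.
set e := commutator a b `|` ker_con f.
set a' := img_con f _; set b' := img_con f _.
have ke : ker_con f <= e by rewrite leUr.
apply: le_anti; apply/andP; split.
  rewrite leUx; apply/andP; split; last first.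
    apply/conleP => x y kxy; have fxy : f x = f y := kxy.
    by change (commutator a' b' (f x) (f y)); rewrite fxy; exact: con_refl.
  apply/con_supP => _ [C CP ->].
  have [_ Cab] := CP A B f fsurj a b.
  apply: (@le_trans _ _ (C A a b `|` ker_con f)); first by rewrite leUl.
  rewrite Cab; apply/conleP => x y.
  by have /conleP := commutator_ge CP a' b'; apply.
have /conleP le_e : commutator a' b' <= img_con f e.
  apply/con_supP => _ [C CP ->].
  have [_ Cab] := CP A B f fsurj a b.
  apply/conleP => u v; have [x <-] := fsurj u; have [y <-] := fsurj v => Cxy.
  apply/img_conE => //; exists x, y; split=> //.
  have Cxy' : (C A a b `|` ker_con f) x y by rewrite Cab.
  have /conleP le_Ce : C A a b `|` ker_con f <= e.
    by apply: leU2 => //; exact: commutator_ge.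
  exact: le_Ce.
apply/conleP => x y /le_e/(img_conE fsurj ke) [x' [y' [xy' fx fy]]].
have /conleP ke' := ke.
by apply: con_trans (con_trans _ xy') _; apply: ke' => //; exact: esym.
Qed.

End Commutator.

Section Quotient.
Variables (S : signature) (V : variety S) (A : member V) (a : con A).

Definition quot_rel : rel {classic A} := fun x y => `[< a x y >].

Fact quot_rel_refl : reflexive quot_rel.
Proof. by move=> x; apply/asboolP; exact: con_refl. Qed.

Fact quot_rel_sym : symmetric quot_rel.
Proof. by move=> x y; apply/asboolP/asboolP; exact: con_sym. Qed.

Fact quot_rel_trans : transitive quot_rel.
Proof.
by move=> y x z /asboolP xy /asboolP yz; apply/asboolP; exact: con_trans xy yz.
Qed.

Canonical quot_equiv :=
  EquivRel quot_rel quot_rel_refl quot_rel_sym quot_rel_trans.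

Definition quot_carrier : Type := {eq_quot quot_equiv}.
Definition quot_pi (x : A) : quot_carrier := \pi_({eq_quot quot_equiv}) (x : {classic A}).
Definition quot_repr (x : quot_carrier) : A := repr (x : {eq_quot quot_equiv}).

Lemma quot_piP x y : quot_pi x = quot_pi y <-> a x y.
Proof.
by split=> [/eqmodP/asboolP//|xy]; apply/eqmodP/asboolP.
Qed.

Lemma quot_reprK x : quot_pi (quot_repr x) = x.
Proof. exact: reprK. Qed.

Fact quot_inhabited : inhabited quot_carrier.
Proof. by have [x] := carrier_inhabited A; split; exact: quot_pi x. Qed.

Definition quot_algebra : algebra S :=
  Algebra (fun o (t : 'I_(arity o) -> quot_carrier) =>
    quot_pi (op (fun i => quot_repr (t i)))) quot_inhabited.

Lemma quot_op (o : symb S) (t : 'I_(arity o) -> A) :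
  @op S quot_algebra o (fun i => quot_pi (t i)) = quot_pi (op t).
Proof. by apply/quot_piP; apply: con_op => i; apply/quot_piP; rewrite quot_reprK. Qed.

Fact quot_satisfies : satisfies V quot_algebra.
Proof.
have evalE v t : @eval S quot_algebra v t = quot_pi (eval (fun n => quot_repr (v n)) t).
  elim: t => [n|o ts IH]; first by rewrite /= quot_reprK.
  rewrite [RHS]/= -quot_op [LHS]/=.
  by congr (quot_pi (op _)); apply/funext => i; rewrite IH.
by move=> e Ve v; rewrite !evalE (member_satisfies Ve).
Qed.

Definition quot : member V := Member quot_satisfies.

End Quotient.

Section Compact.
Variables (S : signature) (V : variety S).

Lemma cg_sub (A : algebra S) (R R' : set (A * A)) : R `<=` R' -> cg R <= cg R'.
Proof. by move=> RR'; apply/cgP => p Rp c; apply; exact: RR'. Qed.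

Lemma compact_con_bot (A : algebra S) : compact_con (\bot : con A).
Proof.
exists set0; first exact: finite_set0.
by apply/esym/eqP; rewrite -lex0; apply/cgP.
Qed.

Lemma compact_con_join (A : algebra S) (a b : con A) :
  compact_con a -> compact_con b -> compact_con (a `|` b).
Proof.
move=> [R fR ->] [R' fR' ->]; exists (R `|` R')%classic.
  by rewrite finite_setU.
apply: le_anti; apply/andP; split.
  by rewrite leUx; apply/andP; split; apply: cg_sub; [left|right].
apply/cgP => p [Rp|Rp].
  have /conleP : cg R <= cg R `|` cg R' by rewrite leUl.
  by apply => c; apply.
have /conleP : cg R' <= cg R `|` cg R' by rewrite leUr.
by apply => c; apply.
Qed.

(* If x is any point of A and theta is generated by the finitely many pairs
   (o(x,...,x), x), then {x/theta} is a subalgebra of A/theta. *)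
Lemma compact_con_top (A : member V) :
  semidegenerate V -> compact_con (\top : con A).
Proof.
move=> sd; have [x] := carrier_inhabited A.
pose R : set (A * A) := [set (op (fun _ : 'I_(arity o) => x), x) | o in [set: symb S]].
exists R; first exact/finite_image/finite_finset.
apply/esym/eqP; rewrite -le1x; apply/conleP => y z _.
apply: contrapT => yz; apply: (sd (quot (cg R))).
  by exists (quot_pi (cg R) y), (quot_pi (cg R) z) => /quot_piP.
exists (quot_pi (cg R) x) => o t tx.
have -> : t = fun _ => quot_pi (cg R) x by apply/funext => i; exact: tx.
apply: (etrans (@quot_op S V A (cg R) o (fun=> x))).
by apply/quot_piP => c cR; apply: (cR (_, _)); exists o.
Qed.

End Compact.

Section Spectrum.
Variables (S : signature) (V : variety S) (A : member V).
Implicit Types (a b c : con A).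

Definition perp a : con A := con_sup [set c | commutator a c = \bot].

Definition prime_con : set (con A) :=
  [set p | p <> \top /\
     forall a b, commutator a b <= p -> a <= p \/ b <= p].

Definition rho a : con A := con_inf [set p | prime_con p /\ a <= p].

Definition spec : Type := set_type prime_con.
HB.instance Definition _ := Choice.on spec.

Definition zariski_open a : set spec := [set p : spec | ~ (a <= val p)].

Lemma zariski_openI a b :
  (zariski_open a `&` zariski_open b)%classic = zariski_open (commutator a b).
Proof.
apply/seteqP; split=> p; rewrite /zariski_open /=.
  by move=> [ap bp] abp; have [_ /(_ _ _ abp)[]] := set_valP p.
move=> abp; have := commutator_le a b; rewrite lexI => /andP[ca cb].
by split=> h; apply: abp; [exact: le_trans ca h|exact: le_trans cb h].
Qed.

Lemma zariski_openU a b :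
  (zariski_open a `|` zariski_open b)%classic = zariski_open (a `|` b).
Proof.
apply/seteqP; split=> p; rewrite /zariski_open /= leUx.
  by move=> [h /andP[? ?]|h /andP[? ?]].
by move=> /negP; rewrite negb_and => /orP[/negP|/negP]; [left|right].
Qed.

Lemma zariski_open_bot : zariski_open \bot = set0.
Proof. by rewrite -subset0 => p; apply; exact: le0x. Qed.

Lemma zariski_open_top : zariski_open \top = [set: spec].
Proof.
apply/seteqP; split=> // p _; rewrite /zariski_open /= le1x => /eqP pT.
by have [] := set_valP p.
Qed.

Definition zariski_opens : set_system spec := range zariski_open.

Fact zariski_opensT : zariski_opens setT.
Proof. by exists \top => //; exact: zariski_open_top. Qed.

Fact zariski_opensI : setI_closed zariski_opens.
Proof.
move=> _ _ [a _ <-] [b _ <-].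
by exists (commutator a b) => //; exact/esym/zariski_openI.
Qed.

Fact zariski_opens_bigU (I : Type) (f : I -> set spec) :
  (forall i, zariski_opens (f i)) -> zariski_opens (\bigcup_i f i).
Proof.
move=> fP; exists (con_sup [set a | exists i, zariski_open a = f i]) => //.
apply/seteqP; split=> p; rewrite /zariski_open /=.
  apply: contra_notP => fp; apply/con_supP => a [i ai]; apply: contrapT => ap.
  by apply: fp; exists i => //; rewrite -ai.
move=> [i _]; have [a _ ai] := fP i; rewrite -ai => ap /con_supP h.
by apply: ap; apply: h; exists i.
Qed.

HB.instance Definition _ := isOpenTopological.Build spec
  zariski_opensT zariski_opensI zariski_opens_bigU.

Definition min_spec : set spec :=
  [set p : spec | forall q : spec, val q <= val p -> q = p].

Lemma rhoP a b : rho a = rho b <-> zariski_open a = zariski_open b.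
Proof.
have sub c d : rho c = rho d -> zariski_open d `<=` zariski_open c.
  move=> cd p; apply: contra_not => cp.
  have : rho d <= val p.
    rewrite -cd; apply: ((con_infP _ _).1 (lexx _)); split=> //.
    exact: set_valP.
  by apply: le_trans; apply/con_infP => q [].
have sub' c d : zariski_open c = zariski_open d -> rho d <= rho c.
  move=> cd; apply/con_infP => p [pp cp].
  apply: ((con_infP _ _).1 (lexx _)); split=> //.
  pose p' : spec := exist _ p (mem_set pp).
  by have /contrapT : ~ zariski_open d p' by rewrite -cd; apply.
split=> ab; first by apply/seteqP; split; exact: sub.
by apply: le_anti; rewrite !sub'.
Qed.

End Spectrum.

Section Complemented.
Context {d : Order.disp_t} {L : tbLatticeType d}.

Definition complemented : set L :=
  [set x | exists y, x `&` y = \bot /\ x `|` y = \top].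

End Complemented.

Section StoneLattice.
Context {d : Order.disp_t} (L : tbDistrLatticeType d).

Definition annihilator (x : L) : set L := [set y | x `&` y = \bot].

Definition stone_lattice :=
  forall x : L, exists2 e, complemented e & annihilator x = [set y | y <= e].

Definition ideal (Q : set L) :=
  [/\ Q \bot, forall x y, y <= x -> Q x -> Q y
    & forall x y, Q x -> Q y -> Q (x `|` y)].

Definition prime_ideal : set (set L) :=
  [set Q | [/\ ideal Q, ~ Q \top
    & forall x y, Q (x `&` y) -> Q x \/ Q y]].

Definition spec_id : Type := set_type prime_ideal.
HB.instance Definition _ := Choice.on spec_id.

Definition stone_basic (x : L) : set spec_id :=
  [set Q : spec_id | ~ (val Q : set L) x].

Definition stone_opens : set_system spec_id :=
  [set U | exists X : set L, U = \bigcup_(x in X) stone_basic x].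

Fact stone_opensT : stone_opens setT.
Proof.
exists [set \top]; apply/esym; rewrite bigcup_set1.
by apply/seteqP; split=> // Q _; have [] := set_valP Q.
Qed.

Fact stone_opensI : setI_closed stone_opens.
Proof.
move=> _ _ [X ->] [Y ->].
exists [set z | exists x y, [/\ X x, Y y & z = x `&` y]].
apply/seteqP; split=> Q.
  move=> [[x Xx xQ] [y Yy yQ]]; exists (x `&` y); first by exists x, y.
  by move=> /=; have [_ _ h] := set_valP Q => /h[].
move=> [_ [x [y [Xx Yy ->]]] xyQ]; have [[_ h _] _ _] := set_valP Q.
split; [exists x|exists y] => //; move: xyQ; apply: contra_not => /=; apply: h.
  exact: leIl.
exact: leIr.
Qed.

Fact stone_opens_bigU (I : Type) (f : I -> set spec_id) :
  (forall i, stone_opens (f i)) -> stone_opens (\bigcup_i f i).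
Proof.
move=> fP; exists [set x | exists i, stone_basic x `<=` f i].
apply/seteqP; split=> Q.
  move=> [i _ fQ]; have [X fX] := fP i; move: fQ; rewrite fX => -[x Xx xQ].
  by exists x => //; exists i; rewrite fX => R xR; exists x.
by move=> [x [i xf] xQ]; exists i => //; exact: xf.
Qed.

HB.instance Definition _ := isOpenTopological.Build spec_id
  stone_opensT stone_opensI stone_opens_bigU.

Definition min_spec_id : set spec_id :=
  [set P : spec_id | forall Q : spec_id,
     (val Q : set L) `<=` val P -> Q = P].

End StoneLattice.

Definition has_continuous_retraction (X : topologicalType) (Y : set X) :=
  exists2 r : X -> set_type Y, continuous r & forall y, r (set_val y) = y.

Section Classes.
Variables (S : signature) (V : variety S) (A : member V).

Definition pure (c : con A) :=
  forall a : con A, compact_con a -> a <= c -> c `|` perp a = \top.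

Definition PF_algebra := forall a : con A, principal a -> pure (perp a).

Definition PP_algebra := forall a : con A, principal a -> complemented (perp a).

Definition commutator_closed :=
  forall a b : con A, compact_con a -> compact_con b ->
    compact_con (commutator a b).

End Classes.

Section Reticulation.
Variables (S : signature) (V : variety S) (A : member V).

Definition retic_rel : rel (set_type (@compact_con S A)) :=
  fun a b => `[< rho (val a) = rho (val b) >].

Fact retic_rel_refl : reflexive retic_rel.
Proof. by move=> a; apply/asboolP. Qed.

Fact retic_rel_sym : symmetric retic_rel.
Proof. by move=> a b; apply/asboolP/asboolP. Qed.

Fact retic_rel_trans : transitive retic_rel.
Proof. by move=> b a c /asboolP ab /asboolP bc; apply/asboolP; rewrite ab. Qed.

Canonical retic_equiv :=
  EquivRel retic_rel retic_rel_refl retic_rel_sym retic_rel_trans.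

(* The two hypotheses are not needed for the carrier but for its lattice
   structure: they make the top congruence and commutators compact. *)
Definition reticulation (V_sd : semidegenerate V) (A_K : commutator_closed A) : Type :=
  {eq_quot retic_equiv}.

Variables (V_sd : semidegenerate V) (A_K : commutator_closed A).
Local Notation K := (set_type (@compact_con S A)).
Local Notation L := (reticulation V_sd A_K).

HB.instance Definition _ := Choice.on L.

Definition retic_pi (a : K) : L := \pi_({eq_quot retic_equiv}) a.
Definition retic_repr (x : L) : K := repr (x : {eq_quot retic_equiv}).

Lemma retic_piP a b : retic_pi a = retic_pi b <-> rho (val a) = rho (val b).
Proof. by split=> [/eqmodP/asboolP//|ab]; apply/eqmodP/asboolP. Qed.

Lemma retic_reprK x : retic_pi (retic_repr x) = x.
Proof. exact: reprK. Qed.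

Definition K_join (a b : K) : K :=
  exist _ (val a `|` val b)
    (mem_set (compact_con_join (set_valP a) (set_valP b))).
Definition K_comm (a b : K) : K :=
  exist _ (commutator (val a) (val b))
    (mem_set (A_K (set_valP a) (set_valP b))).
Definition K_bot : K := exist _ \bot (mem_set (@compact_con_bot S A)).
Definition K_top : K := exist _ \top (mem_set (compact_con_top A V_sd)).

Definition retic_join (x y : L) : L :=
  retic_pi (K_join (retic_repr x) (retic_repr y)).
Definition retic_meet (x y : L) : L :=
  retic_pi (K_comm (retic_repr x) (retic_repr y)).
Definition retic_le : rel L := fun x y => retic_meet x y == x.

Definition retic_supp (x : L) : set (spec A) := zariski_open (val (retic_repr x)).

Lemma retic_supp_pi a : retic_supp (retic_pi a) = zariski_open (val a).
Proof. by apply/rhoP/retic_piP; rewrite retic_reprK. Qed.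

Lemma retic_supp_inj : injective retic_supp.
Proof.
by move=> x y /rhoP xy; rewrite -[x]retic_reprK -[y]retic_reprK; apply/retic_piP.
Qed.

Lemma retic_supp_join x y :
  retic_supp (retic_join x y) = (retic_supp x `|` retic_supp y)%classic.
Proof. by rewrite retic_supp_pi zariski_openU. Qed.

Lemma retic_supp_meet x y :
  retic_supp (retic_meet x y) = (retic_supp x `&` retic_supp y)%classic.
Proof. by rewrite retic_supp_pi zariski_openI. Qed.

Let suppE := (retic_supp_join, retic_supp_meet).

Fact retic_meetC : commutative retic_meet.
Proof. by move=> x y; apply: retic_supp_inj; rewrite !suppE setIC. Qed.

Fact retic_joinC : commutative retic_join.
Proof. by move=> x y; apply: retic_supp_inj; rewrite !suppE setUC. Qed.

Fact retic_meetA : associative retic_meet.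
Proof. by move=> x y z; apply: retic_supp_inj; rewrite !suppE setIA. Qed.

Fact retic_joinA : associative retic_join.
Proof. by move=> x y z; apply: retic_supp_inj; rewrite !suppE setUA. Qed.

Fact retic_joinKI y x : retic_meet x (retic_join x y) = x.
Proof. by apply: retic_supp_inj; rewrite !suppE setUC setKU. Qed.

Fact retic_meetKU y x : retic_join x (retic_meet x y) = x.
Proof. by apply: retic_supp_inj; rewrite !suppE setIC setKI. Qed.

Fact retic_meetUl : left_distributive retic_meet retic_join.
Proof. by move=> x y z; apply: retic_supp_inj; rewrite !suppE setIUl. Qed.

Fact retic_meetxx : idempotent_op retic_meet.
Proof. by move=> x; apply: retic_supp_inj; rewrite !suppE setIid. Qed.

Fact retic_display : Order.disp_t. Proof. exact: Order.Disp tt tt. Qed.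

HB.instance Definition _ :=
  @Order.isMeetJoinDistrLattice.Build retic_display L
    retic_le (fun x y => (y != x) && retic_le x y) retic_meet retic_join
    (fun _ _ => erefl) (fun _ _ => erefl) retic_meetC retic_joinC
    retic_meetA retic_joinA retic_joinKI retic_meetKU retic_meetUl retic_meetxx.

Fact retic_le0x (x : L) : retic_pi K_bot <= x.
Proof.
apply/eqP/retic_supp_inj; rewrite retic_supp_meet retic_supp_pi.
by rewrite zariski_open_bot set0I.
Qed.

Fact retic_lex1 (x : L) : x <= retic_pi K_top.
Proof.
apply/eqP/retic_supp_inj; rewrite retic_supp_meet retic_supp_pi.
by rewrite zariski_open_top setIT.
Qed.

HB.instance Definition _ := Order.hasBottom.Build retic_display L retic_le0x.
HB.instance Definition _ := Order.hasTop.Build retic_display L retic_lex1.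

Lemma retic_piU (a b : K) : retic_pi a `|` retic_pi b = retic_pi (K_join a b).
Proof.
by apply: retic_supp_inj; rewrite [LHS]retic_supp_join !retic_supp_pi zariski_openU.
Qed.

Lemma retic_piI (a b : K) : retic_pi a `&` retic_pi b = retic_pi (K_comm a b).
Proof.
by apply: retic_supp_inj; rewrite [LHS]retic_supp_meet !retic_supp_pi zariski_openI.
Qed.

End Reticulation.

(* Main.v *)
Require Import Defs.
From mathcomp Require Import all_boot all_order.
From mathcomp Require Import all_classical topology.
From Stdlib Require Import Relation_Operators.

(** The commutator is only known as the greatest operation that is compatible
with surjective morphisms, so it has to be computed first. Regard a congruence
[b] as a subalgebra of [A * A] and let [Delta b a] be the congruence on it
generated by the pairs of diagonal elements related by [a]. Then [[a, b]] is
the least [t] such that the pairs in [t] form a union of classes of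
[Delta b a] (commutatorE): this operation is compatible with surjections, and
compatibility with the projection of the algebra [b] to [A] forces every
compatible operation below it. Modularity enters through the shifting lemma.
Complete additivity and symmetry of the commutator can be read off from this
description. So can [[a, \top] = a] (commutator1), because in a semidegenerate
variety a congruence on the algebra [b] with the diagonal in one class is
total.

With this calculus, the PF condition says two things. First, [A] is reduced:
[[a, a]] is trivial only for trivial [a] (PF_reduced). By prime avoidance the
prime congruences then meet in the trivial one, so that the class in [L(A)] of
a compact congruence is [0] only for the trivial congruence, and two classes
are disjoint only if the commutator is trivial. Second, annihilators of
disjoint elements of [L(A)] are comaximal (retic_normal). Complements can be
computed with the commutator, complemented congruences are compact, and so the
PP condition and the Stone condition are the same statement about annihilators
of compact congruences (PP_stone, stone_PP).

The rest concerns spectra, and prime congruences of [A] form the same ordered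
space as prime ideals of [L(A)] (to_spec_id, of_spec_id). In a lattice with
comaximal annihilators, the elements killed by something outside a prime ideal
[Q] form a prime ideal (germ_prime), hence the unique minimal prime below [Q].
When the lattice is Stone, sending [Q] to this minimal prime is continuous
(stone_retraction). A retract of the spectrum of [A] is compact because the
total congruence is compact (spec_compact). Finally, if the minimal primes form
a compact space, then for each [x] a single [y] disjoint from [x] witnesses
that [x] lies in minimal primes, and normality turns [y] into a complemented
generator of the annihilator of [x] (min_compact_stone). *)

Set Implicit Arguments.
Unset Strict Implicit.
Unset Printing Implicit Defensive.

Import Order.TTheory.
Local Open Scope classical_set_scope.
Local Open Scope order_scope.

(** * Chains of congruences and the subalgebra of a square carried by a congruence *)

(** Joins of congruences, and congruences generated by compatible tolerances,
are made of chains. Both cases share one stability hypothesis: it is enough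
that the elementary steps survive changing a single argument of an operation,
since arities are finite and arguments can be changed one at a time. *)
Section Chains.
Variables (S : signature) (A : algebra S) (T : A -> A -> Prop).

Definition update n (t : 'I_n -> A) i x : 'I_n -> A :=
  fun j => if j == i then x else t j.

Hypothesis T_sym : forall x y, T x y -> T y x.
Hypothesis T_update : forall (o : symb S) (t : 'I_(arity o) -> A) i x y,
  T x y -> T (op (update t i x)) (op (update t i y)).

Let chain := clos_refl_trans A T.

Fact chain_sym x y : chain x y -> chain y x.
Proof.
elim=> [{}x {}y /T_sym|{}x|{}x {}y z _ yx _ zy]; first exact: rt_step.
  exact: rt_refl.
exact: rt_trans zy yx.
Qed.

Fact chain_update (o : symb S) (t : 'I_(arity o) -> A) i x y :
  chain x y -> chain (op (update t i x)) (op (update t i y)).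
Proof.
elim=> [{}x {}y /T_update xy|{}x|{}x {}y z _ xy _]; first exact/rt_step/xy.
  exact: rt_refl.
exact: rt_trans xy.
Qed.

Fact chain_op (o : symb S) (t u : 'I_(arity o) -> A) :
  (forall i, chain (t i) (u i)) -> chain (op t) (op u).
Proof.
move=> tu; pose w k : 'I_(arity o) -> A := fun j => if (j < k)%N then u j else t j.
(* [w k] has the first [k] arguments of [u] and the others of [t]. *)
have -> : u = w (arity o) by apply/funext => j; rewrite /w ltn_ord.
have : (arity o <= arity o)%N by [].
elim: {-2}(arity o) => [|k IH] ko.
  by rewrite (_ : w 0%N = t); [exact: rt_refl|exact/funext].
apply: rt_trans (IH (ltnW ko)) _; pose i := Ordinal ko.
have -> : w k = update (w k) i (t i).
  by apply/funext => j; rewrite /update; case: eqP => // ->; rewrite /w /= ltnn.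
have -> : w k.+1 = update (w k) i (u i).
  apply/funext => j; rewrite /update; case: eqP => [->|/eqP ji].
    by rewrite /w /= ltnS leqnn.
  by rewrite /w ltnS leq_eqVlt (_ : (_ == k :> nat) = false)//; apply/negbTE.
exact: chain_update.
Qed.

Definition chain_con : con A :=
  Con (rt_refl A T) chain_sym (@rt_trans A T) chain_op.

Lemma cg_chain (R : set (A * A)) : (forall p, R p -> T p.1 p.2) ->
  forall x y, cg R x y -> clos_refl_trans A T x y.
Proof.
by move=> RT x y /(_ chain_con); apply=> p Rp; apply: rt_step; exact: RT.
Qed.

End Chains.

(** A congruence [a] saturates [P] when [P] is a union of [a]-classes; one
inclusion is enough because [a] is symmetric. This is the form in which
centrality is closed under joins. *)
Definition saturates (S : signature) (A : algebra S) (a : con A) (P : set A) :=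
  forall x y, a x y -> P x -> P y.

Lemma con_sup_chain (S : signature) (A : algebra S) (X : set (con A)) x y :
  con_sup X x y ->
  clos_refl_trans A (fun x y => exists2 a : con A, X a & a x y) x y.
Proof.
apply: cg_chain => [{}x {}y [a Xa xy]|o t i {}x {}y [a Xa xy]|[] //].
  by exists a => //; exact: con_sym.
exists a => //; apply: con_op => j; rewrite /update.
by case: eqP => // _; exact: con_refl.
Qed.

Lemma saturates_sup (S : signature) (A : algebra S) (X : set (con A)) P :
  (forall a, X a -> saturates a P) -> saturates (con_sup X) P.
Proof.
move=> XP x y /con_sup_chain; elim=> // [{}x {}y [a Xa xy]|].
  exact: XP xy.
by move=> {x y} u v w _ uv _ vw /uv /vw.
Qed.

Lemma saturatesU (S : signature) (A : algebra S) (a b : con A) P :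
  saturates a P -> saturates b P -> saturates (a `|` b) P.
Proof. by move=> aP bP; apply: saturates_sup => c [->|->]. Qed.

Lemma saturates_le (S : signature) (A : algebra S) (a b : con A) P :
  a <= b -> saturates b P -> saturates a P.
Proof. by move=> /conleP ab bP x y /ab; exact: bP. Qed.

Section PairAlgebra.
Variables (S : signature) (V : variety S) (A : member V) (b : con A).

(** The congruence [b] as a subalgebra of [A * A]. *)
Record pair_carrier := Pair { pr0 : A; pr1 : A; pairP : b pr0 pr1 }.

Lemma pair_ext p q : pr0 p = pr0 q -> pr1 p = pr1 q -> p = q.
Proof.
by case: p q => [x y xy] [x' y' xy'] /= xx yy; subst x' y'; congr Pair;
   exact: Prop_irrelevance.
Qed.

Definition diag (x : A) : pair_carrier := Pair (con_refl b x).

Fact pair_inhabited : inhabited pair_carrier.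
Proof. by have [x] := carrier_inhabited A; split; exact: diag x. Qed.

Definition pair_algebra : algebra S := Algebra
  (fun o (t : 'I_(arity o) -> pair_carrier) => Pair (con_op (fun i => pairP (t i))))
  pair_inhabited.

Fact pair_satisfies : satisfies V pair_algebra.
Proof.
have eval0 v t : pr0 (@Defs.eval S pair_algebra v t) = Defs.eval (fun n => pr0 (v n)) t.
  by elim: t => //= o ts IH; congr op; exact/funext.
have eval1 v t : pr1 (@Defs.eval S pair_algebra v t) = Defs.eval (fun n => pr1 (v n)) t.
  by elim: t => //= o ts IH; congr op; exact/funext.
move=> e Ve v; apply: pair_ext.
  by rewrite !eval0 (member_satisfies Ve).
by rewrite !eval1 (member_satisfies Ve).
Qed.

Definition pairs : member V := Member pair_satisfies.

Definition proj0 : hom pairs A := @Hom S pairs A pr0 (fun _ _ => erefl).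
Definition proj1 : hom pairs A := @Hom S pairs A pr1 (fun _ _ => erefl).

Fact diag_op (o : symb S) (t : 'I_(arity o) -> A) :
  diag (op t) = @op S pairs o (fun i => diag (t i)).
Proof. exact: pair_ext. Qed.

Definition diag_hom : hom A pairs := @Hom S A pairs diag diag_op.

(** The congruence generated on [b] by the pairs of diagonal elements that [a]
relates. Its pairs are two-by-two matrices with rows in [b] and columns in
[a]. *)
Definition Delta (a : con A) : con pairs := img_con diag_hom a.

Lemma Delta_leP a (c : con pairs) : Delta a <= c <-> a <= preim_con diag_hom c.
Proof.
split=> [/cgP ac|/conleP ac]; last first.
  by apply/cgP => _ [x [y [xy ->]]]; exact: ac.
by apply/conleP => x y xy; apply: (ac (diag x, diag y)); exists x, y.
Qed.

Lemma Delta_diag (a : con A) x y : a x y -> Delta a (diag x) (diag y).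
Proof. by have /Delta_leP/conleP := lexx (Delta a); apply. Qed.

End PairAlgebra.


(** * Centralizers in a congruence-modular variety *)

Lemma con_meetE (S : signature) (A : algebra S) (a b : con A) x y :
  (a `&` b) x y <-> a x y /\ b x y.
Proof.
change (con_meet a b x y <-> a x y /\ b x y).
split=> [ab|[axy bxy] c [->|->]//].
by split; apply: ab; [left|right].
Qed.

Lemma con_joinl (S : signature) (A : algebra S) (a b : con A) x y :
  a x y -> (a `|` b) x y.
Proof. by have /conleP := leUl a b; apply. Qed.

Lemma con_joinr (S : signature) (A : algebra S) (a b : con A) x y :
  b x y -> (a `|` b) x y.
Proof. by have /conleP := leUr b a; apply. Qed.

Arguments con_joinl {S A a b x y} _.
Arguments con_joinr {S A a b x y} _.
Arguments con_meetE {S A a b x y}.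

Lemma preim_con_le (S : signature) (A B : algebra S) (f : hom A B) (b c : con B) :
  b <= c -> preim_con f b <= preim_con f c.
Proof. by move=> /conleP bc; apply/conleP => x y; exact: bc. Qed.

Lemma con_sup_ub (S : signature) (A : algebra S) (X : set (con A)) a :
  X a -> a <= con_sup X.
Proof. by move: a; exact/con_supP/lexx. Qed.

Lemma con_inf_lb (S : signature) (A : algebra S) (X : set (con A)) a :
  X a -> con_inf X <= a.
Proof. by move: a; exact/con_infP/lexx. Qed.

Lemma ker_con_preim (S : signature) (A B : algebra S) (f : hom A B) b :
  ker_con f <= preim_con f b.
Proof. exact/preim_con_le/le0x. Qed.

Section Centralizers.
Variables (S : signature) (V : variety S) (V_mod : congruence_modular V).

(** The shifting lemma of Gumm: in the parallelogram with sides [p q], [r s]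
in [e1] and [p r], [q s] in [e0], a relation on the side [p q] moves to the
opposite side. It is the modular law for [g /\ e1 <= e1] read on elements. *)
Lemma shifting (A : member V) (e0 e1 g : con A) p q r s :
  e0 `&` e1 <= g -> e0 r p -> g p q -> e1 p q -> e0 q s -> e1 r s -> g r s.
Proof.
move=> eg rp gpq epq qs rs.
have /conleP : (e0 `|` (g `&` e1)) `&` e1 <= g.
  rewrite joinC V_mod; last exact: leIr.
  by rewrite leUx leIl.
apply; apply/con_meetE; split=> //.
apply: (con_trans (con_joinl rp)); apply: (con_trans _ (con_joinl qs)).
by apply: con_joinr; apply/con_meetE.
Qed.

Section FixedAlgebra.
Variable A : member V.
Implicit Types a b c t : con A.

Let eta0 b := ker_con (proj0 b).
Let eta1 b := ker_con (proj1 b).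

Fact etaI b (c : con (pairs b)) : eta0 b `&` eta1 b <= c.
Proof.
apply/conleP => p q /con_meetE[pq0 pq1]; rewrite (pair_ext pq0 pq1).
exact: con_refl.
Qed.

Lemma Delta_le0 b a : Delta b a <= preim_con (proj0 b) a.
Proof. by apply/Delta_leP/conleP. Qed.

Lemma Delta_le1 b a : Delta b a <= preim_con (proj1 b) a.
Proof. by apply/Delta_leP/conleP. Qed.

Lemma Delta_mono b a a' : a <= a' -> Delta b a <= Delta b a'.
Proof.
move=> aa'; apply/Delta_leP; apply: le_trans aa' _.
exact/Delta_leP/lexx.
Qed.

Lemma preim_proj0 b t : preim_con (proj0 b) t <= Delta b t `|` eta0 b.
Proof.
apply/conleP => p q pq.
have h r : eta0 b r (diag b (pr0 r)) by [].
apply: con_trans (con_joinr (h p)) _.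
apply: con_trans _ (con_joinr (con_sym (h q))).
exact/con_joinl/Delta_diag.
Qed.

(** The term condition modulo [t], with the matrices of [Delta b a]: if one
row of a matrix lies in [t], then so does the other. *)
Definition centralizes a b t :=
  saturates (Delta b a) [set p | t (pr0 p) (pr1 p)].

(** In the term condition [t] occurs on both rows, and on the right-hand side
only as an upper bound; so monotonicity in [t] is visible only in this form.
Shifting gives one direction. For the other, rows related by [Delta b a] are
moved into one fibre of the second projection at the cost of a step in [t],
and the modular law takes that step out of the meet. *)
Lemma centralizesP a b t :
  centralizes a b t <-> Delta b a `&` eta1 b <= preim_con (proj0 b) t.
Proof.
split=> [ct|le_t].
  apply/conleP => p q /con_meetE[pq pq1].
  have xy := pairP p; have zy := pairP q.
  have xz : b (pr0 p) (pr0 q).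
    by apply: con_trans xy _; rewrite [pr1 p]pq1; exact: con_sym.
  pose r := Pair xz; pose s := diag b (pr0 q).
  have /con_sym rs : Delta b a r s by apply: (@shifting _ _ _ _ p q r s (etaI _)).
  by apply: (ct _ _ rs); exact: con_refl.
move=> q p qp tq.
pose s := diag b (pr1 q); pose r := diag b (pr1 p).
have sr : Delta b a s r 
  by apply: Delta_diag; have /conleP le1 := Delta_le1 b a; exact: (le1 _ _ qp).
suff : preim_con (proj0 b) t p r by [].
have /conleP : (eta1 b `&` preim_con (proj0 b) t `|` Delta b a) `&` eta1 b
    <= preim_con (proj0 b) t.
  by rewrite V_mod ?leIl// leUx leIr.
apply; apply/con_meetE; split=> //.
apply: con_trans (con_joinr (con_sym qp)) _.
apply: con_trans _ (con_joinr sr).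
by apply: con_joinl; apply/con_meetE; split.
Qed.

Lemma centralizes_le a b t t' : t <= t' -> centralizes a b t -> centralizes a b t'.
Proof.
move=> tt' /centralizesP ct; apply/centralizesP; apply: le_trans ct _.
exact: preim_con_le.
Qed.

Lemma centralizes_inf a b (X : set (con A)) :
  (forall t, X t -> centralizes a b t) -> centralizes a b (con_inf X).
Proof. by move=> XP p q pq Xp t Xt; apply: XP pq _ => //; exact: Xp. Qed.

Lemma centralizes_l a b : centralizes a b a.
Proof.
by apply/centralizesP; apply: le_trans (Delta_le0 _ _); exact: leIl.
Qed.

Lemma centralizes_r a b : centralizes a b b.
Proof. by move=> p q _ _; exact: pairP. Qed.

(** [Delta b] turns joins into joins, and saturation passes to joins: this is
where the complete additivity of the commutator comes from. *)
Lemma centralizes_sup (X : set (con A)) b t :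
  (forall a, X a -> centralizes a b t) -> centralizes (con_sup X) b t.
Proof.
move=> XP.
apply: (@saturates_le _ _ _ (con_sup [set c | exists2 a, X a & c = Delta b a])).
  apply/Delta_leP/con_supP => a Xa; apply/Delta_leP.
  by apply: con_sup_ub; exists a.
by apply: saturates_sup => _ [a Xa ->]; exact: XP.
Qed.

(** Transposing the matrices of [Delta b a] gives a tolerance [R] whose pairs
are matrices of [Delta a b] on their side. [R] contains the generators of
[Delta b a], so its chains exhaust [Delta b a], and the hypothesis, in the
form [D1] that compares columns rather than rows, carries [t] along each
link of a chain. *)
Lemma centralizes_sym a b t : t <= a `&` b ->
  centralizes b a t -> centralizes a b t.
Proof.
rewrite lexI => /andP[ta tb] bat.
(* The mirror image of centralizesP, for the first projection. *)
have D0 : Delta a b `&` eta0 a <= preim_con (proj1 a) t.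
  apply/conleP => p q /con_meetE[pq pq0].
  have zx := con_sym (pairP p); have xw := pairP q.
  have zw : a (pr1 p) (pr1 q).
    by apply: con_trans zx _; rewrite [pr0 p]pq0.
  pose r := diag a (pr1 p); pose s := Pair zw.
  have rs : Delta a b r s.
    apply: (@shifting _ (eta1 a) (eta0 a) _ p q r s) => //.
    by rewrite meetC; exact: etaI.
  by apply: (bat _ _ rs); exact: con_refl.
have /conleP D1 : Delta a b `&` preim_con (proj0 a) t <= preim_con (proj1 a) t.
  apply: (@le_trans _ _ ((Delta a t `|` eta0 a) `&` Delta a b)).
    by rewrite meetC leI2// preim_proj0.
  rewrite V_mod; last exact: Delta_mono.
  by rewrite leUx Delta_le1/= meetC.
(* [dR p q]: the rows [p], [q] have their columns, as elements of [a], related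
   by [Delta a b]. Quantifying over the columns avoids choosing proofs that
   they belong to [a]; [R] is its symmetrization. *)
pose dR (p q : pairs b) := [/\ a (pr0 p) (pr0 q), a (pr1 p) (pr1 q) &
  forall p' q' : pairs a, pr0 p' = pr0 p -> pr1 p' = pr0 q ->
    pr0 q' = pr1 p -> pr1 q' = pr1 q -> Delta a b p' q'].
pose R p q := dR p q /\ dR q p.
have dRxx p : dR p p.
  split; [exact: con_refl|exact: con_refl|move=> p' q' e1 e2 e3 e4].
  rewrite (_ : p' = diag a (pr0 p)); last exact: pair_ext.
  rewrite (_ : q' = diag a (pr1 p)); last exact: pair_ext.
  exact/Delta_diag/pairP.
have dRop (o : symb S) (u v : 'I_(arity o) -> pairs b) :
    (forall i, dR (u i) (v i)) -> dR (op u) (op v).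
  move=> uv.
  have uv0 i : a (pr0 (u i)) (pr0 (v i)) by case: (uv i).
  have uv1 i : a (pr1 (u i)) (pr1 (v i)) by case: (uv i).
  split; [exact: con_op|exact: con_op|move=> p' q' e1 e2 e3 e4].
  rewrite (_ : p' = @op S (pairs a) o (fun i => Pair (uv0 i))); last exact: pair_ext.
  rewrite (_ : q' = @op S (pairs a) o (fun i => Pair (uv1 i))); last exact: pair_ext.
  by apply: con_op => i; case: (uv i) => _ _; apply.
have Rsym p q : R p q -> R q p by case.
have Rup (o : symb S) (u : 'I_(arity o) -> pairs b) i p q :
    R p q -> R (op (update u i p)) (op (update u i q)).
  by case=> pq qp; split; apply: dRop => j; rewrite /update; case: eqP.
move=> p q; move/(cg_chain Rsym Rup) => pq.
have dR_diag x y : a x y -> dR (diag b x) (diag b y).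
  move=> xy; split=> // p' q' e1 e2 e3 e4.
  by rewrite (_ : p' = q'); [exact: con_refl|apply: pair_ext; rewrite ?e1 ?e2].
have {pq} : clos_refl_trans _ R p q.
  by apply: pq => _ [x [y [xy ->]]]; split; apply: dR_diag; [|exact: con_sym].
elim=> // [{}p {}q [[xz yw pq] _] /= xy|].
  have {}pq := pq (Pair xz) (Pair yw) erefl erefl erefl erefl.
  by apply: (D1 (Pair xz) (Pair yw)); apply/con_meetE.
by move=> {}p {}q r _ pq _ qr /pq /qr.
Qed.

End FixedAlgebra.
End Centralizers.


(** * The greatest commutator is given by centralizers *)

Section Images.
Variables (S : signature) (A B : algebra S) (f : hom A B).
Hypothesis f_surj : forall y, exists x, f x = y.

Lemma img_con_le a c : img_con f a <= c <-> a <= preim_con f c.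
Proof.
split=> [/cgP ac|/conleP ac].
  by apply/conleP => x y xy; apply: (ac (f x, f y)); exists x, y.
by apply/cgP => _ [x [y [xy ->]]]; exact: ac.
Qed.

Lemma preim_conK c : img_con f (preim_con f c) = c.
Proof.
apply: le_anti; apply/andP; split; first exact/img_con_le.
apply/conleP => u v uv; have [x ux] := f_surj u; have [y vy] := f_surj v.
apply/img_conE => //; first exact: ker_con_preim.
by exists x, y; rewrite /= ux vy.
Qed.

Lemma img_conK a : ker_con f <= a -> preim_con f (img_con f a) = a.
Proof.
move=> ka; apply: le_anti; apply/andP; split; last exact/img_con_le.
apply/conleP => x y /(img_conE f_surj ka)[x' [y' [xy' xx' yy']]].
have /conleP ka' := ka.
by apply: con_trans (con_trans _ xy') _; apply: ka' => //; exact: esym.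
Qed.

End Images.

Section ModularCommutator.
Variables (S : signature) (V : variety S) (V_mod : congruence_modular V).

Section ImageCentralizers.
Variables (A B : member V) (f : hom A B).
Hypothesis f_surj : forall y, exists x, f x = y.

(** Since [f] maps the subalgebra [b] onto its image, the set saturated in the
definition of centrality for the images is the image of the one for [a], [b],
[t], which is trivially saturated under the kernel of the induced map. *)
Lemma centralizes_img a b t : ker_con f <= b -> ker_con f <= t ->
  centralizes a b t <->
  centralizes (img_con f a) (img_con f b) (img_con f t).
Proof.
move=> kb kt.
have preim_t := img_conK f_surj kt.
have Fb (p : pairs b) : img_con f b (f (pr0 p)) (f (pr1 p)).
  have /conleP : b <= preim_con f (img_con f b) by exact/img_con_le.
  by apply; exact: pairP.
pose F0 (p : pairs b) : pairs (img_con f b) := Pair (Fb p).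
have F0op (o : symb S) (u : 'I_(arity o) -> pairs b) :
    F0 (op u) = op (fun i => F0 (u i)) by apply: pair_ext => /=; exact: homP.
pose F := @Hom S (pairs b) (pairs (img_con f b)) F0 F0op.
have F_surj (q : pairs (img_con f b)) : exists p, F p = q.
  have /(img_conE f_surj kb)[x [y [xy xq yq]]] := pairP q.
  by exists (Pair xy); exact: pair_ext.
have Ft (p : pairs b) : img_con f t (pr0 (F p)) (pr1 (F p)) = t (pr0 p) (pr1 p).
  by rewrite -[in RHS]preim_t.
have Fdiag x : F (diag b x) = diag _ (f x) by exact: pair_ext.
split=> [ct|ct' p q pq]; last first.
  have pq' : Delta (img_con f b) (img_con f a) (F p) (F q).
    have /conleP : Delta b a <= preim_con F (Delta (img_con f b) (img_con f a)).
      apply/Delta_leP/conleP => x y xy.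
      change (Delta (img_con f b) (img_con f a) (F (diag b x)) (F (diag b y))).
      rewrite !Fdiag; apply: Delta_diag.
      by have /conleP : a <= preim_con f (img_con f a) by [exact/img_con_le]; apply.
    exact.
  by rewrite /= -!Ft; exact: ct' _ _ pq'.
have cK : saturates (Delta b a `|` ker_con F) [set p | t (pr0 p) (pr1 p)].
  apply: saturatesU => // p q pq /=; have {}pq : F p = F q := pq.
  by rewrite -!Ft pq.
have KD : ker_con F <= Delta b a `|` ker_con F by exact: leUr.
have /conleP le_img : Delta (img_con f b) (img_con f a) <=
    img_con F (Delta b a `|` ker_con F).
  apply/Delta_leP/img_con_le/conleP => x y xy.
  change (img_con F (Delta b a `|` ker_con F) (diag _ (f x)) (diag _ (f y))).
  rewrite -!Fdiag; apply/(img_conE F_surj KD); exists (diag b x), (diag b y).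
  by split=> //; exact/con_joinl/Delta_diag.
move=> u v /le_img/(img_conE F_surj KD)[p [q [pq <- <-]]].
change (img_con f t (pr0 (F p)) (pr1 (F p)) ->
        img_con f t (pr0 (F q)) (pr1 (F q))).
by rewrite !Ft; exact: (cK _ _ pq).
Qed.

End ImageCentralizers.

Definition least_centralized (A : member V) (a b : con A) : con A :=
  con_inf [set t | centralizes a b t].

Lemma least_centralizedP (A : member V) (a b t : con A) :
  least_centralized a b <= t <-> centralizes a b t.
Proof.
split=> [|ct]; last exact: con_inf_lb.
by move/(centralizes_le V_mod); apply; exact: centralizes_inf.
Qed.

Lemma least_centralizedC (A : member V) (a b : con A) :
  least_centralized a b = least_centralized b a.
Proof.
have le a' b' : least_centralized a' b' <= least_centralized b' a' :> con A.
  apply/least_centralizedP/(centralizes_sym V_mod); last exact/least_centralizedP.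
  rewrite lexI; apply/andP.
  by split; apply/least_centralizedP; [exact: centralizes_r|exact: centralizes_l].
by apply: le_anti; rewrite !le.
Qed.

Lemma least_centralized_sup (A : member V) (X : set (con A)) (b t : con A) :
  least_centralized (con_sup X) b <= t <->
  forall a, X a -> least_centralized a b <= t.
Proof.
split=> [/least_centralizedP ct a Xa|XP]; last first.
  apply/least_centralizedP/centralizes_sup => a Xa.
  exact/least_centralizedP/XP.
apply/least_centralizedP; apply: saturates_le ct; apply: Delta_mono.
exact: con_sup_ub.
Qed.

Lemma least_centralizedU (A : member V) (a a' b t : con A) :
  least_centralized (a `|` a') b <= t =
  (least_centralized a b <= t) && (least_centralized a' b <= t).
Proof.
apply/idP/andP => [/least_centralized_sup h|[at_ at'_]].
  by split; apply: h; [left|right].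
by apply/least_centralized_sup => _ [->|->].
Qed.

Lemma least_centralized_le (A : member V) (a b : con A) :
  least_centralized a b <= a `&` b.
Proof.
rewrite lexI; apply/andP.
by split; apply/least_centralizedP; [exact: centralizes_l|exact: centralizes_r].
Qed.

(** Compatibility with a surjection of kernel [k] reduces, by additivity, to
congruences that contain [k], because commutators with [k] lie below [k]; for
those it is centralizes_img. *)
Lemma least_centralized_axiom : commutator_axiom least_centralized.
Proof.
move=> A B f f_surj a b; split; first exact: least_centralized_le.
set k := ker_con f; set D' := least_centralized (img_con f _) _.
have ka : k <= a `|` k by exact: leUr.
have kb : k <= b `|` k by exact: leUr.
have joinP t : k <= t ->
    least_centralized a b <= t <-> centralizes (a `|` k) (b `|` k) t.
  move=> kt; rewrite -least_centralizedP least_centralizedU.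
  have h c : least_centralized k c <= t.
    by apply: le_trans kt; have := least_centralized_le k c; rewrite lexI => /andP[].
  rewrite h andbT (least_centralizedC a (b `|` k)) least_centralizedU h andbT.
  by rewrite least_centralizedC.
apply: le_anti; apply/andP; split.
  rewrite leUx ker_con_preim andbT; apply/joinP; first exact: ker_con_preim.
  apply/(centralizes_img f_surj) => //; first exact: ker_con_preim.
  by rewrite preim_conK//; exact/least_centralizedP.
set t := _ `|` k; have kt : k <= t by exact: leUr.
rewrite -[leRHS](img_conK f_surj kt); apply: preim_con_le.
apply/least_centralizedP/(centralizes_img f_surj) => //.
by apply/joinP => //; exact: leUl.
Qed.

(** The lower bound is least_centralized_axiom. For the upper bound, apply the
compatibility of an arbitrary operation [C] with the first projection of the
algebra [b] to [Delta b a] and to the kernel [k1] of the second projection: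
these two project onto [a] and [b], and [C] lies below their meet, which
centralizesP sends below any centralized congruence. *)
Lemma commutatorE (A : member V) (a b : con A) :
  commutator a b = least_centralized a b.
Proof.
apply: le_anti; apply/andP; split; last exact/commutator_ge/least_centralized_axiom.
apply/con_supP => _ [C CP ->].
pose f := proj0 b; pose k0 := ker_con f; pose k1 := ker_con (proj1 b).
have f_surj x : exists p, f p = x by exists (diag b x).
have ea : Delta b a `|` k0 = preim_con f a.
  apply: le_anti; apply/andP; split; last exact: preim_proj0.
  by rewrite leUx Delta_le0 ker_con_preim.
have eb : k1 `|` k0 = preim_con f b.
  apply: le_anti; apply/andP; split.
    rewrite leUx ker_con_preim andbT; apply/conleP => p q pq.
    apply: con_trans (pairP p) _; rewrite [pr1 p]pq; exact/con_sym/pairP.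
  apply/conleP => p q pq; have xz : b (pr0 p) (pr0 q) := pq.
  have xw := con_trans xz (pairP q).
  have h1 : k0 p (Pair xw) by [].
  have h2 : k1 (Pair xw) q by [].
  exact: (con_trans (con_joinr h1) (con_joinl h2)).
have [C_le C_pre] := CP (pairs b) A f f_surj (Delta b a) k1.
have := C_pre; rewrite ea eb !preim_conK// => C_pre'.
rewrite -(preim_conK f_surj (C A a b)) -C_pre'; apply/img_con_le.
rewrite leUx ker_con_preim andbT; apply: le_trans C_le _.
by apply/(centralizesP V_mod)/least_centralizedP.
Qed.

End ModularCommutator.


(** * Commutator calculus and prime congruences *)

Section CompactCongruences.
Variables (S : signature) (A : algebra S).
Implicit Types (a b c : con A) (X : set (con A)).

Lemma cg_pair_le c x y : cg [set (x, y)] <= c <-> c x y.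
Proof. by rewrite cgP; split=> [/(_ _ erefl)//|xy _ ->]. Qed.

Lemma principal_compact x y : compact_con (cg [set (x, y)] : con A).
Proof. by exists [set (x, y)] => //; exact: finite_set1. Qed.

Lemma le_compacts a b :
  (forall c, compact_con c -> c <= a -> c <= b) -> a <= b.
Proof.
move=> ab; apply/conleP => x y /cg_pair_le xy; apply/cg_pair_le.
exact: ab (principal_compact x y) xy.
Qed.

Lemma compact_con_ind (P : con A -> Prop) :
  P \bot -> (forall x y, P (cg [set (x, y)])) ->
  (forall a b, compact_con a -> compact_con b -> P a -> P b -> P (a `|` b)) ->
  forall c, compact_con c -> P c.
Proof.
move=> P0 P1 PU _ [R /(@finite_seqP {classic (A * A)})[s ->] ->].
suff : compact_con (cg [set` s]) /\ P (cg [set` s]) by case.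
elim: s => [|[x y] s [cs Ps]].
  rewrite (_ : cg _ = \bot); first by split=> //; exact: compact_con_bot.
  by apply/eqP; rewrite -lex0; apply/cgP.
rewrite (_ : cg _ = cg [set (x, y)] `|` cg [set` s]).
  split; last by apply: PU => //; exact: principal_compact.
  by apply: compact_con_join => //; exact: principal_compact.
apply: le_anti; apply/andP; split.
  apply/cgP => p /=; rewrite inE => /orP[/eqP ->|ps].
    by apply: con_joinl; apply/cg_pair_le.
  by apply: con_joinr; have /cgP := lexx (cg [set` s] : con A); apply.
rewrite leUx; apply/andP; split; apply: cg_sub => p /=.
  by move=> ->; rewrite inE eqxx.
by rewrite inE => ->; rewrite orbT.
Qed.

Definition directed X := X !=set0 /\
  forall a b, X a -> X b -> exists c, [/\ X c, a <= c & b <= c].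

(** Compactness in the order sense, for directed joins: a chain witnessing that
[con_sup X] relates two points uses finitely many members of [X]. *)
Lemma compact_directed c X : compact_con c -> directed X ->
  c <= con_sup X -> exists2 a, X a & c <= a.
Proof.
move=> cc [[a0 Xa0] Xdir]; elim/compact_con_ind: c / cc.
- by move=> _; exists a0 => //; exact: le0x.
- move=> x y /cg_pair_le /con_sup_chain xy.
  suff [a Xa axy] : exists2 a, X a & a x y by exists a => //; apply/cg_pair_le.
  elim: {x y} xy => [//|x|x y z _ [a Xa axy] _ [b Xb byz]].
    by exists a0 => //; exact: con_refl.
  have [c [Xc /conleP ac /conleP bc]] := Xdir _ _ Xa Xb; exists c => //.
  exact: con_trans (ac _ _ axy) (bc _ _ byz).
- move=> a b _ _ IHa IHb; rewrite leUx => /andP[/IHa[a' Xa' aa'] /IHb[b' Xb' bb']].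
  have [c [Xc ac bc]] := Xdir _ _ Xa' Xb'; exists c => //.
  by rewrite leUx (le_trans aa' ac) (le_trans bb' bc).
Qed.

Lemma compact_join_split c a b : compact_con c -> c <= a `|` b ->
  exists a' b',
    [/\ compact_con a' /\ a' <= a, compact_con b' /\ b' <= b & c <= a' `|` b'].
Proof.
move=> cc cab.
pose X := [set d | exists a' b', [/\ compact_con a' /\ a' <= a,
  compact_con b' /\ b' <= b & d = a' `|` b']].
have Xin a' b' : compact_con a' -> a' <= a -> compact_con b' -> b' <= b ->
  X (a' `|` b') by move=> *; exists a', b'.
have bot_c : compact_con (\bot : con A) by exact: compact_con_bot.
have Xdir : directed X.
  split; first by exists (\bot `|` \bot); apply: Xin => //; exact: le0x.
  move=> _ _ [a1 [b1 [[? ?] [? ?] ->]]] [a2 [b2 [[? ?] [? ?] ->]]].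
  exists ((a1 `|` a2) `|` (b1 `|` b2)); split.
  - by apply: Xin; rewrite ?leUx; (try by apply/andP; split) => //;
      exact: compact_con_join.
  - by rewrite joinACA leUl.
  - by rewrite joinACA leUr.
have cX : c <= con_sup X.
  apply: le_trans cab _; rewrite leUx; apply/andP; split; apply: le_compacts.
    move=> d cd da; rewrite -(joinx0 d).
    by apply/con_sup_ub/Xin => //; exact: le0x.
  move=> d cd db; rewrite -(join0x d).
  by apply/con_sup_ub/Xin => //; exact: le0x.
by have [_ [a' [b' [ha hb ->]]] ?] := compact_directed cc Xdir cX; exists a', b'.
Qed.

End CompactCongruences.

Section CommutatorAlgebra.
Variables (S : signature) (V : variety S) (V_mod : congruence_modular V).
Variable (A : member V).
Implicit Types a b c t : con A.

Let E := commutatorE V_mod.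

Lemma commutatorC a b : commutator a b = commutator b a.
Proof. by rewrite !E; exact: least_centralizedC. Qed.

Lemma commutator_sup_le (X : set (con A)) b t :
  commutator (con_sup X) b <= t <-> forall a, X a -> commutator a b <= t.
Proof.
rewrite E least_centralized_sup//.
by split=> h a /h; rewrite E.
Qed.

Lemma commutator_lel a b : commutator a b <= a.
Proof. by have := commutator_le a b; rewrite lexI => /andP[]. Qed.

Lemma commutator_ler a b : commutator a b <= b.
Proof. by have := commutator_le a b; rewrite lexI => /andP[]. Qed.

Lemma commutatorUl a a' b :
  commutator (a `|` a') b = commutator a b `|` commutator a' b.
Proof.
have le_iff t : commutator (a `|` a') b <= t <->
    commutator a b `|` commutator a' b <= t.
  rewrite leUx; split=> [/commutator_sup_le h|/andP[? ?]].
    by apply/andP; split; apply: h; [left|right].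
  by apply/commutator_sup_le => _ [->|->].
by apply: le_anti; apply/andP; split; apply/le_iff.
Qed.

Lemma commutatorUr a b b' :
  commutator a (b `|` b') = commutator a b `|` commutator a b'.
Proof. by rewrite commutatorC commutatorUl !(commutatorC a). Qed.

Lemma commutator_mono a a' b b' :
  a <= a' -> b <= b' -> commutator a b <= commutator a' b'.
Proof.
move=> aa' bb'; rewrite -(join_r aa') -(join_r bb') commutatorUl.
by rewrite commutatorUr -joinA leUl.
Qed.

Lemma perpP a c : c <= perp a <-> commutator a c = \bot.
Proof.
split=> [ca|]; last exact: con_sup_ub.
apply/eqP; rewrite -lex0; apply: le_trans (commutator_mono (lexx a) ca) _.
by rewrite commutatorC; apply/commutator_sup_le => d ad; rewrite commutatorC ad.
Qed.

End CommutatorAlgebra.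

Section Semidegenerate.
Variables (S : signature) (V : variety S).
Hypotheses (V_mod : congruence_modular V) (V_sd : semidegenerate V).

(** The class of [x] is a one-element subalgebra of the quotient by [c]. *)
Lemma idempotent_class_top (A : member V) (c : con A) x :
  (forall o : symb S, c (op (fun _ : 'I_(arity o) => x)) x) -> c = \top.
Proof.
move=> cx; apply/eqP; rewrite -le1x; apply/conleP => y z _.
apply: contrapT => yz; apply: (V_sd (A := quot c)).
  by exists (quot_pi c y), (quot_pi c z) => /quot_piP.
exists (quot_pi c x) => o t tx.
rewrite (_ : t = fun=> quot_pi c x); last by apply/funext => i; exact: tx.
by apply: (etrans (@quot_op S V A c o (fun=> x))); apply/quot_piP.
Qed.

Variable A : member V.
Implicit Types a b c t : con A.

(** In the algebra [a] the congruence [Delta a \top] has the whole diagonal in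
one class, which is thus idempotent; so semidegeneracy makes it the total
congruence. Every pair in [a] is then related to a diagonal pair, and lies in
each centralized congruence. *)
Lemma commutator1 a : commutator a \top = a.
Proof.
apply: le_anti; rewrite commutator_lel/= commutatorC// commutatorE//.
have DT : Delta a \top = \top.
  have [x] := carrier_inhabited A.
  apply: (@idempotent_class_top (pairs a) _ (diag a x)) => o.
  rewrite (_ : op _ = diag a (op (fun _ : 'I_(arity o) => x)) :> pairs a).
    exact: Delta_diag.
  exact: pair_ext.
set t := least_centralized _ _; apply/conleP => x y xy.
have ct : centralizes \top a t by exact/(least_centralizedP V_mod).
have yx : Delta a \top (diag a y) (Pair xy) by rewrite DT.
by apply: (ct _ _ yx); exact: con_refl.
Qed.

Lemma perp0 : perp (\bot : con A) = \top.
Proof. by apply/eqP; rewrite -le1x; apply/perpP; rewrite ?commutator1. Qed.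

Lemma commutator_comaximal a b c :
  a `|` c = \top -> b `|` c = \top -> commutator a b `|` c = \top.
Proof.
move=> ac bc; apply/eqP; rewrite -le1x -(commutator1 \top) -{1}ac -bc.
rewrite commutatorUl// !commutatorUr// !leUx leUl/=.
by rewrite !(le_trans _ (leUr _ _)) ?commutator_ler ?commutator_lel.
Qed.

(** With commutator1, a commutator that vanishes on a comaximal pair is as good
as a meet; hence complements may be computed with the commutator, for which
distributivity is available. *)
Lemma disjoint_of_comaximal a b :
  commutator a b = \bot -> a `|` b = \top -> a `&` b = \bot.
Proof.
move=> ab0 ab1; apply/eqP; rewrite -lex0 -[leLHS]commutator1 -ab1 commutatorUr//.
rewrite leUx; apply/andP; split; rewrite -ab0; last exact: commutator_mono (leIl _ _) _.
by rewrite commutatorC//; exact: commutator_mono _ (leIr _ _).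
Qed.

Lemma complementedP a : complemented a <->
  exists b, commutator a b = \bot /\ a `|` b = \top.
Proof.
split=> [] [b [ab0 ab1]]; exists b; split=> //.
  by apply/eqP; rewrite -lex0 -ab0 commutator_le.
exact: disjoint_of_comaximal.
Qed.

Lemma complemented_compact a : complemented a -> compact_con a.
Proof.
move=> /complementedP[b [ab0 ab1]].
have [|a' [b' [[ca' a'a] [_ b'b] le1]]] :=
    @compact_join_split _ _ \top a b (compact_con_top A V_sd).
  by rewrite ab1.
suff -> : a = a' by [].
apply: le_anti; rewrite a'a andbT -[leLHS]commutator1.
have -> : \top = a' `|` b.
  by apply/eqP; rewrite eq_sym -le1x; apply: le_trans le1 _; exact: leU2.
by rewrite commutatorUr// ab0 joinx0 commutator_ler.
Qed.

Lemma complementedI a b : complemented a -> complemented b -> complemented (a `&` b).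
Proof.
move=> /complementedP[a' [aa0 aa1]] /complementedP[b' [bb0 bb1]].
apply/complementedP; exists (a' `|` b'); split.
  rewrite commutatorUr//; apply/eqP; rewrite -lex0 leUx; apply/andP; split.
    by rewrite -aa0; exact: commutator_mono (leIl _ _) _.
  by rewrite -bb0; exact: commutator_mono (leIr _ _) _.
have aa' : a `|` (a' `|` b') = \top by rewrite joinA aa1 join1x.
have bb' : b `|` (a' `|` b') = \top by rewrite joinCA bb1 joinx1.
apply/eqP; rewrite -le1x -(commutator_comaximal aa' bb') leU2//.
exact: commutator_le.
Qed.

Lemma perpU a b : perp (a `|` b) = perp a `&` perp b.
Proof.
have perpE c : (c <= perp (a `|` b)) = (c <= perp a `&` perp b).
  rewrite lexI; apply/idP/andP => [/perpP|[/perpP ac /perpP bc]].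
    rewrite commutatorUl// => /(_ V_mod)/eqP; rewrite -lex0 leUx !lex0.
    by move=> /andP[/eqP ? /eqP ?]; split; exact/perpP.
  by apply/perpP => //; rewrite commutatorUl// ac// bc// joinxx.
by apply: le_anti; rewrite perpE lexx -perpE lexx.
Qed.

Section PF.
Hypothesis A_PF : PF_algebra A.

(** A compact congruence is a finite join of principal ones, [perp] turns this
join into a meet, and comaximality with [perp b] is inherited by meets. *)
Lemma PF_compact a b : compact_con a -> compact_con b ->
  commutator a b = \bot -> perp a `|` perp b = \top.
Proof.
move=> ca cb; elim/compact_con_ind: a / ca.
- by move=> _; rewrite perp0 join1x.
- move=> x y xyb; apply: A_PF => //; first by exists x, y.
  exact/perpP.
- move=> a a' _ _ IHa IHa'; rewrite commutatorUl// => /eqP.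
  rewrite -lex0 leUx !lex0 => /andP[/eqP/IHa h /eqP/IHa' h'].
  rewrite perpU; apply/eqP; rewrite -le1x -(commutator_comaximal h h').
  by rewrite leU2// commutator_le.
Qed.

(** A compact [c] with [[c, c]] trivial is comaximal with itself in the sense
of PF_compact, so [perp c] is the total congruence and [c = [c, \top]] is
trivial. *)
Lemma PF_reduced a : commutator a a = \bot -> a = \bot.
Proof.
move=> aa; apply/eqP; rewrite -lex0; apply: le_compacts => c cc ca.
have c0 : commutator c c = \bot.
  by apply/eqP; rewrite -lex0 -aa commutator_mono.
have := PF_compact cc cc c0; rewrite joinxx => c1.
by rewrite -[c]commutator1 -c1 lex0; apply/eqP/perpP.
Qed.

End PF.

(** The prime avoidance principle for multiplicative systems [M]. Compactness of
the members of [M] makes the congruences that avoid [M] closed under unions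
of chains, so that Zorn's lemma applies; a maximal one is prime. *)
Lemma prime_con_avoiding (M : set (con A)) t : M !=set0 ->
  (forall m, M m -> compact_con m) ->
  (forall m n, M m -> M n -> exists2 k, M k & k <= commutator m n) ->
  (forall m, M m -> ~ m <= t) ->
  exists p, [/\ prime_con p, t <= p & forall m, M m -> ~ m <= p].
Proof.
move=> [m0 Mm0] M_compact M_mult tM.
pose good (p : con A) := t <= p /\ forall m, M m -> ~ m <= p.
pose T := {p : con A | good p}; pose t0 : T := exist good t (conj (lexx t) tM).
pose le (p q : T) := sval p <= sval q.
have [|||[p [tp pM]] p_max] := @ZL_preorder T t0 le.
- by move=> p; exact: lexx.
- by move=> q p r; exact: le_trans.
- move=> C C_tot; have [[c0 Cc0]|C0] := pselect (exists u, C u); last first.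
    by exists t0 => u Cu; case: C0; exists u.
  pose X := [set sval u | u in C].
  have Xdir : directed X.
    split; first by exists (sval c0), c0.
    move=> _ _ [c Cc <-] [d Cd <-]; have [cd|dc] := C_tot _ _ Cc Cd.
      by exists (sval d); split=> //; exists d.
    by exists (sval c); split=> //; exists c.
  have ub : good (con_sup X).
    split=> [|m Mm].
      by apply: (le_trans (svalP c0).1); apply: con_sup_ub; exists c0.
    move=> /(compact_directed (M_compact _ Mm) Xdir)[_ [c Cc <-]].
    exact: (svalP c).2.
  by exists (exist good _ ub) => c Cc; apply: con_sup_ub; exists c.
exists p; split=> //; split=> [p1|a b abp].
  by apply: (pM _ Mm0); rewrite p1 lex1.
have above c : c <= p \/ exists2 m, M m & m <= p `|` c.
  have [cM|] := pselect (forall m, M m -> ~ m <= p `|` c); last first.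
    by move=> /existsNP[m /not_implyP[Mm /contrapT mc]]; right; exists m.
  have tpc : good (p `|` c).
    by split=> //; apply: (le_trans tp); exact: leUl.
  left; have := p_max (exist good _ tpc); rewrite /le/= leUl => /(_ isT).
  by rewrite leUx => /andP[].
have [|[m Mm ma]] := above a; first by left.
have [|[n Mn nb]] := above b; first by right.
have [k Mk kmn] := M_mult _ _ Mm Mn; case: (pM _ Mk).
apply: (le_trans kmn); apply: (le_trans (commutator_mono V_mod ma nb)).
by rewrite commutatorUl// !commutatorUr// !leUx abp !commutator_lel commutator_ler.
Qed.

Lemma prime_con_above t : t <> \top -> exists2 p, prime_con p & t <= p.
Proof.
move=> t1; have [||_ _ -> ->|_ ->|p [pp tp _]] := @prime_con_avoiding [set \top] t.
- by exists \top.
- by move=> _ ->; exact: compact_con_top.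
- by exists \top => //; rewrite commutator1.
- by rewrite le1x => /eqP.
- by exists p.
Qed.

(** The system is that of the iterated squares of a nontrivial compact
congruence below [c]; none of them is trivial when [A] is reduced. *)
Lemma prime_con_missing c : commutator_closed A ->
  (forall a, commutator a a = \bot -> a = \bot) -> c <> \bot ->
  exists2 p, prime_con p & ~ c <= p.
Proof.
move=> A_K red c0.
have [c' [cc' c'c c'0]] : exists c', [/\ compact_con c', c' <= c & c' <> \bot].
  apply: contrapT => h; apply: c0; apply/eqP; rewrite -lex0.
  apply: le_compacts => d cd dc; rewrite lex0; apply/eqP; apply: contrapT => d0.
  by apply: h; exists d.
pose m := fix m n := if n is n'.+1 then commutator (m n') (m n') else c'.
have m_compact n : compact_con (m n) by elim: n => [//|n IH]; exact: (A_K _ _ IH IH).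
have m0 n : m n <> \bot by elim: n => //= n IH /red.
have m_le i j : m (i + j)%N <= m j.
  by elim: i => //= i IH; exact: le_trans (commutator_lel _ _) IH.
have [|_ [n _ <-]|_ _ [i _ <-] [j _ <-]|_ [n _ <-]|p [pp _ pM]] :=
    @prime_con_avoiding [set m n | n in setT] \bot.
- by exists c', 0%N.
- exact: m_compact.
- exists (m (i + j).+1); first by exists (i + j).+1.
  by apply: commutator_mono => //; rewrite addnC.
- by rewrite lex0 => /eqP/m0.
- by exists p => // cp; apply: (pM c'); [exists 0%N|exact: le_trans cp].
Qed.

End Semidegenerate.


(** * Retractions and minimal prime ideals of normal lattices *)

Section Subspaces.

Lemma set_type_continuous (X X' : topologicalType) (Y : set X')
    (f : X -> set_type Y) :
  continuous (fun x => set_val (f x)) -> continuous f.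
Proof. exact: (@continuous_comp_initial (set_type Y) X X' set_val f). Qed.

Lemma set_val_continuous (X : topologicalType) (Y : set X) :
  continuous (set_val : set_type Y -> X).
Proof. exact: initial_continuous. Qed.

Lemma compact_surjection (X X' : topologicalType) (f : X -> X') :
  continuous f -> (forall y, exists x, f x = y) ->
  compact [set: X] -> compact [set: X'].
Proof.
move=> f_cont f_surj /(continuous_compact (continuous_subspaceT f_cont)).
suff -> : f @` setT = setT by [].
by apply/seteqP; split=> // y _; have [x <-] := f_surj y; exists x.
Qed.

Lemma retract_compact (X : topologicalType) (Y : set X) :
  compact [set: X] -> has_continuous_retraction Y -> compact [set: set_type Y].
Proof.
move=> Xc [r r_cont rK]; apply: compact_surjection r_cont _ Xc => y.
by exists (set_val y).
Qed.

Section Homeomorphism.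
Variables (X X' : topologicalType) (f : X -> X') (g : X' -> X).
Variables (Y : set X) (Y' : set X').
Hypotheses (f_cont : continuous f) (g_cont : continuous g).
Hypotheses (fY : forall x, Y x -> Y' (f x)) (gY : forall x, Y' x -> Y (g x)).

Lemma retraction_transfer : cancel f g ->
  has_continuous_retraction Y' -> has_continuous_retraction Y.
Proof.
move=> fK [r r_cont rK].
exists (fun x => exist _ (g (set_val (r (f x)))) (mem_set (gY (set_valP (r (f x)))))).
  apply: set_type_continuous => x.
  apply: (@continuous_comp _ _ _ (fun x => set_val (r (f x))) g); last exact: g_cont.
  apply: (@continuous_comp _ _ _ (fun x => r (f x)) set_val).
    by apply: continuous_comp; [exact: f_cont|exact: r_cont].
  exact: set_val_continuous.
move=> y; apply: val_inj => /=.
have := rK (exist _ (f (set_val y)) (mem_set (fY (set_valP y)))).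
by move=> ->; rewrite /= fK.
Qed.

Lemma subspace_compact_transfer : cancel g f ->
  compact [set: set_type Y] -> compact [set: set_type Y'].
Proof.
move=> gK.
pose h (y : set_type Y) : set_type Y' :=
  exist _ (f (set_val y)) (mem_set (fY (set_valP y))).
apply: (@compact_surjection _ _ h).
  apply: set_type_continuous => y.
  apply: (@continuous_comp _ _ _ set_val f); last exact: f_cont.
  exact: set_val_continuous.
move=> y; exists (exist _ (g (set_val y)) (mem_set (gY (set_valP y)))).
by apply: val_inj; rewrite /= gK.
Qed.

End Homeomorphism.
End Subspaces.

Section NormalLattice.
Context {d : Order.disp_t} (L : tbDistrLatticeType d).
Implicit Types (x y z : L) (Q : set L).

(** Annihilators of disjoint elements are comaximal; this is the notion of
normal lattice due to Cornish, and the lattice form of the PF condition. *)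
Definition normal_lattice := forall x y, x `&` y = \bot ->
  exists u v, [/\ u `&` x = \bot, v `&` y = \bot & u `|` v = \top].

(** The elements that vanish near [Q] in the spectrum: the kernel of the
localization at [Q]. *)
Definition germ Q : set L := [set x | exists2 a, ~ Q a & a `&` x = \bot].

Lemma germ_sub Q : prime_ideal Q -> germ Q `<=` Q.
Proof.
move=> [[Q0 _ _] _ Qp] x [a aQ ax0].
by have [|/aQ|] := Qp a x; rewrite ?ax0.
Qed.

Lemma germ_antimono Q Q' : Q' `<=` Q -> germ Q `<=` germ Q'.
Proof. by move=> Q'Q x [a aQ ax]; exists a => // /Q'Q. Qed.

Hypothesis L_normal : normal_lattice.

(** If [x /\ y] is killed by [a] outside [Q], normality gives comaximal [u], [v]
that kill [a /\ x] and [y], and they cannot both belong to [Q]. As every prime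
below [Q] contains the germ ideal, the latter is the only minimal prime below
[Q]. *)
Lemma germ_prime Q : prime_ideal Q -> prime_ideal (germ Q).
Proof.
move=> Qprime; have [[Q0 Qle QU] Q1 Qp] := Qprime.
split; last 1 first.
- move=> x y [a aQ axy].
  have [|u [v [uax vy uv]]] := L_normal (x := a `&` x) (y := y).
    by rewrite -meetA.
  have [uQ|uQ] := pselect (Q u); last first.
    left; exists (u `&` a); last by rewrite -meetA.
    by move/Qp => [].
  right; exists v => // vQ; apply: Q1; rewrite -uv; exact: QU.
- split.
  + by exists \top => //; rewrite meetx0.
  + move=> x y yx [a aQ ax]; exists a => //.
    by apply/eqP; rewrite -lex0 -ax leI2.
  + move=> x y [a aQ ax] [b bQ bY]; exists (a `&` b).
      by move/Qp => [].
    by rewrite meetUr meetAC ax meet0x -meetA bY meetx0 joinxx.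
- by move/(germ_sub Qprime).
Qed.

Definition germ_spec (Q : spec_id L) : spec_id L :=
  exist _ (germ (val Q)) (mem_set (germ_prime (set_valP Q))).

Lemma germ_spec_min (Q : spec_id L) : min_spec_id (germ_spec Q).
Proof.
move=> P PQ; apply: val_inj; apply/seteqP; split=> // x.
move/(@germ_antimono _ _ (subset_trans PQ (germ_sub (set_valP Q)))).
exact: (germ_sub (set_valP P)).
Qed.

Lemma germ_spec_id (P : spec_id L) : min_spec_id P -> germ_spec P = P.
Proof. by apply; exact: (germ_sub (set_valP P)). Qed.

Lemma stone_basic_open x : open (stone_basic x : set (spec_id L)).
Proof. by exists [set x]; rewrite bigcup_set1. Qed.

(** The retraction sends [Q] to the minimal prime below it. When the
annihilator of [x] is generated by a complemented [e], an element outside [Q]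
kills [x] if and only if [e] is outside [Q], so the inverse images of basic
open sets are basic open sets. *)
Lemma stone_retraction : stone_lattice L ->
  has_continuous_retraction (@min_spec_id d L).
Proof.
move=> L_stone.
exists (fun Q : spec_id L =>
  exist _ (germ_spec Q) (mem_set (germ_spec_min (Q := Q)))); last first.
  by move=> P; apply: val_inj; exact/germ_spec_id/(set_valP P).
apply: set_type_continuous; apply/continuousP => _ [X ->].
rewrite preimage_bigcup; apply: bigcup_open => x _.
have [e [e' [ee0 ee1]] Ann_x] := L_stone x.
rewrite (_ : _ @^-1` _ = stone_basic e'); first exact: stone_basic_open.
have AnnE y : (x `&` y = \bot) <-> y <= e.
  by rewrite -[_ = _]/(annihilator x y) Ann_x.
apply/seteqP; split=> Q; have [[Q0 Qle QU] Q1 Qp] := set_valP Q.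
  move=> /= xQ e'Q; apply: xQ; exists e; last by rewrite meetC; apply/AnnE.
  by move=> eQ; apply: Q1; rewrite -ee1; exact: QU.
move=> /= e'Q [a aQ]; rewrite meetC => /AnnE ae; apply: aQ; apply: Qle ae _.
by have [|//|//] := Qp e e'; rewrite ee0.
Qed.

(** On minimal primes, [x] belongs to [P] if and only if some [y] disjoint from
[x] does not. Compactness reduces these [y] to a single one, so that [x \/ y]
lies in no minimal prime; normality applied to [x] and [y] then yields [u]
and [v] that are disjoint because every minimal prime contains [u /\ v], and
[u] generates the annihilator of [x]. *)
Lemma min_compact_stone :
  (forall z, (forall Q : spec_id L, (val Q : set L) z) -> z = \bot) ->
  compact [set: set_type (@min_spec_id d L)] -> stone_lattice L.
Proof.
move=> L_sep Min_compact x.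
pose In (P : set_type (@min_spec_id d L)) : set L := val (val P).
have In_prime P : prime_ideal (In P) by exact: (set_valP (val P)).
have nbhs_notin P z : ~ In P z -> nbhs P [set P' | ~ In P' z].
  move=> Pz; apply: open_nbhs_nbhs; split=> //.
  by exists (stone_basic z) => //; exact: stone_basic_open.
have min_sep z : (forall P, In P z) -> z = \bot.
  move=> Pz; apply: L_sep => Q.
  apply: (germ_sub (set_valP Q)).
  exact: (Pz (exist _ (germ_spec Q) (mem_set (germ_spec_min (Q := Q))))).
have [y xy0 xyP] : exists2 y, x `&` y = \bot & forall P, ~ In P (x `|` y).
  apply: contrapT => noy.
  (* Without such [y], the sets of minimal primes containing [x \/ y] form a
     filter base; a cluster point contains [x] and each [y] disjoint from [x],
     which minimality forbids. *)
  pose F : set_system (set_type (@min_spec_id d L)) :=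
    [set U | exists2 y, x `&` y = \bot & forall P, In P (x `|` y) -> U P].
  have FF : ProperFilter F.
    split.
      move=> [y xy0 Fy]; apply: noy; exists y => // P /Fy; exact.
    split.
    - by exists \bot => //; rewrite meetx0.
    - move=> U W [y xy0 Uy] [z xz0 Wz]; exists (y `|` z).
        by rewrite meetUr xy0 xz0 joinxx.
      move=> P; have [[_ Ple _] _ _] := In_prime P => Pxyz.
      by split; [apply: Uy|apply: Wz]; apply: Ple Pxyz; rewrite leU2// ?leUl ?leUr.
    - by move=> U W UW [y xy0 Uy]; exists y => // P /Uy /UW.
  have [|P [_ FP]] := Min_compact F FF; first by exists \bot; rewrite ?meetx0.
  have [[P0 Ple PU] P1 Pp] := In_prime P.
  have Px : In P x.
    apply: contrapT => /nbhs_notin xP.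
    have Fx : F [set P' | In P' x].
      exists \bot; first by rewrite meetx0.
      by move=> P'; rewrite joinx0.
    by have [P' [/= h /(_ h)]] := FP _ _ Fx xP.
  have germP : germ (In P) = In P := congr1 val (germ_spec_id (set_valP P)).
  have [y yP yx] : germ (In P) x by rewrite germP.
  have Fy : F [set P' | In P' y].
    exists y; first by rewrite meetC.
    move=> P'; have [[_ P'le _] _ _] := In_prime P'.
    by apply: P'le; exact: leUr.
  by have [P' [/= h /(_ h)]] := FP _ _ Fy (nbhs_notin _ _ yP).
have [u [v [ux vy uv]]] := L_normal xy0.
have uv0 : u `&` v = \bot.
  apply: min_sep => P; have [[P0 Ple PU] P1 Pp] := In_prime P.
  have [|//|/xyP//] := Pp (u `&` v) (x `|` y).
  by rewrite meetUr meetAC ux meet0x -meetA vy meetx0 joinxx.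
exists u; first by exists v.
apply/seteqP; split=> z /=; last first.
  by move=> zu; apply/eqP; rewrite -lex0 -ux meetC leI2.
move=> xz0.
have zv : z `&` v = \bot.
  apply: min_sep => P; have [[P0 Ple PU] P1 Pp] := In_prime P.
  have [|//|/xyP//] := Pp (z `&` v) (x `|` y).
  by rewrite meetUr meetAC (meetC z x) xz0 meet0x -meetA vy meetx0 joinxx.
by rewrite -[z]meetx1 -uv meetUr zv joinx0 leIr.
Qed.

End NormalLattice.


(** * The spectrum of the reticulation *)

Section Spectra.
Variables (S : signature) (V : variety S).
Hypotheses (V_mod : congruence_modular V) (V_sd : semidegenerate V).
Variables (A : member V) (A_K : commutator_closed A).
Local Notation L := (reticulation V_sd A_K).
Implicit Types (a b c : con A) (x y : L).

(** For a filter [F], the congruences whose basic open set has its complement in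
[F] are directed; as the total congruence is compact their join is proper,
and any prime above that join is a cluster point. *)
Lemma spec_compact : compact [set: spec A].
Proof.
move=> F FF _; pose X : set (con A) := [set a | F (~` zariski_open a)%classic].
have Xdir : directed X.
  split.
    by exists \bot; rewrite /X /= zariski_open_bot setC0; exact: filterT.
  move=> a b Xa Xb; exists (a `|` b); rewrite leUl leUr; split=> //.
  by rewrite /X /= -zariski_openU setCU; exact: filterI.
have [X1|X1] := pselect (con_sup X = \top).
  have [|a Xa] := compact_directed (compact_con_top A V_sd) Xdir.
    by rewrite X1.
  rewrite le1x => /eqP a1; have := Xa; rewrite /X /= a1 zariski_open_top setCT.
  by move/filter_ex => [].
have [p pp Xp] := prime_con_above V_mod V_sd X1.
exists (exist _ p (mem_set pp)); split=> // U W FU.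
rewrite nbhsE => -[_ [[a _ <-] ap] aW].
apply: contrapT => UW0; apply: ap => /=; apply: le_trans Xp; apply: con_sup_ub.
apply: filterS FU => q Uq aq; apply: UW0; exists q; split=> //; exact: aW.
Qed.

(** The map onto the reticulation, on compact congruences rather than on the
subtype, so that proofs of compactness can be changed freely. *)
Definition lam c (cc : compact_con c) : L :=
  retic_pi V_sd A_K (exist _ c (mem_set cc)).

Lemma lam_surj x : exists c (cc : compact_con c), x = lam cc.
Proof.
exists (val (retic_repr x)), (set_valP (retic_repr x)).
by rewrite -[LHS]retic_reprK; apply/retic_piP.
Qed.

Lemma supp_lam c (cc : compact_con c) : retic_supp (lam cc) = zariski_open c.
Proof. exact: retic_supp_pi. Qed.

Lemma lam_le a b (ca : compact_con a) (cb : compact_con b) :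
  lam ca <= lam cb <-> zariski_open a `<=` zariski_open b.
Proof.
rewrite -[zariski_open a](supp_lam ca) -[zariski_open b](supp_lam cb).
split=> [/eqP <-|ab].
  by rewrite retic_supp_meet; exact: subIsetr.
by apply/eqP/retic_supp_inj; rewrite retic_supp_meet; exact/setIidl.
Qed.

Lemma lam_mono a b (ca : compact_con a) (cb : compact_con b) :
  a <= b -> lam ca <= lam cb.
Proof. by move=> ab; apply/lam_le => p ap bp; apply: ap; exact: le_trans bp. Qed.

Lemma lamU a b (ca : compact_con a) (cb : compact_con b) :
  lam ca `|` lam cb = lam (compact_con_join ca cb).
Proof. by rewrite /lam retic_piU; apply/retic_piP. Qed.

Lemma lamI a b (ca : compact_con a) (cb : compact_con b) :
  lam ca `&` lam cb = lam (A_K ca cb).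
Proof. by rewrite /lam retic_piI; apply/retic_piP. Qed.

Lemma lam0 (c0 : compact_con (\bot : con A)) : lam c0 = \bot.
Proof. exact/retic_piP. Qed.

Lemma lam1 (c1 : compact_con (\top : con A)) : lam c1 = \top.
Proof. exact/retic_piP. Qed.

(** Prime congruences of [A] and prime ideals of the reticulation correspond
through their compact members, as [lam c] belongs to [ideal_of p] exactly when
[c <= p], and [c <= con_of Q] exactly when [lam c] belongs to [Q]. *)
Definition ideal_of (p : con A) : set L :=
  [set x | exists c (cc : compact_con c), x = lam cc /\ c <= p].

Lemma ideal_of_lam (p : con A) c (cc : compact_con c) : prime_con p ->
  ideal_of p (lam cc) <-> c <= p.
Proof.
move=> pp; split=> [[b [cb [cE bp]]]|cp]; last by exists c, cc.
have /lam_le cb' : lam cc <= lam cb by rewrite cE.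
apply: contrapT => cp.
exact: (cb' (exist _ p (mem_set pp)) cp bp).
Qed.

Lemma ideal_of_prime p : prime_con p -> prime_ideal (ideal_of p).
Proof.
move=> pp; have [p1 p_prime] := pp; split.
- split.
  + by rewrite -(lam0 (@compact_con_bot S A)); apply/ideal_of_lam => //; exact: le0x.
  + move=> x y; have [a [ca ->]] := lam_surj x; have [b [cb ->]] := lam_surj y.
    move=> /lam_le ba /ideal_of_lam -/(_ pp) ap; apply/ideal_of_lam => //.
    apply: contrapT => bp.
    exact: (ba (exist _ p (mem_set pp)) bp ap).
  + move=> x y; have [a [ca ->]] := lam_surj x; have [b [cb ->]] := lam_surj y.
    move=> /ideal_of_lam -/(_ pp) ap /ideal_of_lam -/(_ pp) bp.
    by rewrite lamU; apply/ideal_of_lam => //; rewrite leUx ap.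
- rewrite -(lam1 (compact_con_top A V_sd)) => /ideal_of_lam -/(_ pp).
  by rewrite le1x => /eqP.
- move=> x y; have [a [ca ->]] := lam_surj x; have [b [cb ->]] := lam_surj y.
  rewrite lamI => /ideal_of_lam -/(_ pp) /p_prime.
  by move=> [ap|bp]; [left|right]; apply/ideal_of_lam.
Qed.

Definition con_of (Q : set L) : con A :=
  con_sup [set c | exists cc : compact_con c, Q (lam cc)].

Lemma con_of_compact Q c (cc : compact_con c) : prime_ideal Q ->
  c <= con_of Q <-> Q (lam cc).
Proof.
move=> [[Q0 Qle QU] _ _]; split=> [cQ|Qc]; last by apply: con_sup_ub; exists cc.
have Xdir : directed [set c | exists cc : compact_con c, Q (lam cc)].
  split; first by exists \bot, (@compact_con_bot S A); rewrite lam0.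
  move=> a b [ca Qa] [cb Qb]; exists (a `|` b); rewrite leUl leUr; split=> //.
  by exists (compact_con_join ca cb); rewrite -lamU; exact: QU.
have [a [ca Qa] c_le_a] := compact_directed cc Xdir cQ.
by apply: Qle Qa; exact: lam_mono.
Qed.

Lemma con_of_prime Q : prime_ideal Q -> prime_con (con_of Q).
Proof.
move=> Qprime; have [[Q0 Qle QU] Q1 Qp] := Qprime; split=> [Q1'|a b abQ].
  apply: Q1; rewrite -(lam1 (compact_con_top A V_sd)).
  by apply/con_of_compact => //; rewrite Q1'.
have [aQ|/existsNP[a' /not_implyP[ca /not_implyP[a'a a'Q]]]] :=
    pselect (forall a', compact_con a' -> a' <= a -> a' <= con_of Q).
  by left; exact: le_compacts.
right; apply: le_compacts => b' cb b'b; apply/(con_of_compact cb Qprime).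
have [||//] := Qp (lam ca) (lam cb).
  rewrite lamI; apply/con_of_compact => //.
  by apply: le_trans abQ; exact: commutator_mono.
by move/(con_of_compact ca Qprime).
Qed.

Definition to_spec_id (p : spec A) : spec_id L :=
  exist _ (ideal_of (val p)) (mem_set (ideal_of_prime (set_valP p))).

Definition of_spec_id (Q : spec_id L) : spec A :=
  exist _ (con_of (val Q)) (mem_set (con_of_prime (set_valP Q))).

Lemma to_spec_idK : cancel to_spec_id of_spec_id.
Proof.
move=> p; apply: val_inj => /=.
have ip := ideal_of_prime (set_valP p).
apply: le_anti; apply/andP; split; apply: le_compacts => c cc.
  by move/(con_of_compact cc ip)/(ideal_of_lam cc (set_valP p)).
by move=> cp; apply/(con_of_compact cc ip)/ideal_of_lam => //; exact: set_valP.
Qed.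

Lemma of_spec_idK : cancel of_spec_id to_spec_id.
Proof.
move=> Q; apply: val_inj => /=; have Qp := set_valP Q.
apply/seteqP; split=> x; have [c [cc ->]] := lam_surj x.
  by move/(ideal_of_lam cc (con_of_prime Qp))/(con_of_compact cc Qp).
by move=> Qc; apply/(ideal_of_lam cc (con_of_prime Qp))/(con_of_compact cc Qp).
Qed.

Lemma to_spec_id_continuous : continuous to_spec_id.
Proof.
apply/continuousP => _ [X ->]; rewrite preimage_bigcup; apply: bigcup_open => x _.
have [c [cc ->]] := lam_surj x; exists c => //; apply/seteqP; split=> p /=.
  by move=> cp; apply: contra_not cp => /(ideal_of_lam cc (set_valP p)).
by move=> cp; apply: contra_not cp => /(ideal_of_lam cc (set_valP p)).
Qed.

Lemma of_spec_id_continuous : continuous of_spec_id.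
Proof.
apply/continuousP => _ [a _ <-].
exists [set x | exists c (cc : compact_con c), x = lam cc /\ c <= a].
apply/seteqP; split=> Q; rewrite /zariski_open /=.
  move=> aQ; apply: contrapT => h; apply: aQ; apply: le_compacts => c cc ca.
  apply/(con_of_compact cc (set_valP Q)); apply: contrapT => cQ; apply: h.
  by exists (lam cc) => //; exists c, cc.
move=> [_ [c [cc [-> ca]]] cQ] aQ; apply: cQ.
by apply/(con_of_compact cc (set_valP Q)); exact: le_trans aQ.
Qed.

Lemma of_spec_id_mono (Q Q' : spec_id L) :
  (val Q : set L) `<=` val Q' -> val (of_spec_id Q) <= val (of_spec_id Q').
Proof.
move=> QQ'; apply/con_supP => c [cc Qc].
by apply/(con_of_compact cc (set_valP Q')); exact: QQ'.
Qed.

Lemma to_spec_id_mono (p p' : spec A) :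
  val p <= val p' -> (val (to_spec_id p) : set L) `<=` val (to_spec_id p').
Proof.
by move=> pp' x [c [cc [-> cp]]]; exists c, cc; split=> //; exact: le_trans pp'.
Qed.

Lemma to_spec_id_min (p : spec A) : min_spec p -> min_spec_id (to_spec_id p).
Proof.
move=> p_min Q /of_spec_id_mono; rewrite to_spec_idK => /p_min <-.
by rewrite of_spec_idK.
Qed.

Lemma of_spec_id_min (Q : spec_id L) : min_spec_id Q -> min_spec (of_spec_id Q).
Proof.
move=> Q_min p /to_spec_id_mono; rewrite of_spec_idK => /Q_min <-.
by rewrite to_spec_idK.
Qed.

(** The elements of the reticulation are by construction determined by the
primes of [A] that miss them. *)
Lemma retic_separated x : (forall Q : spec_id L, (val Q : set L) x) -> x = \bot.
Proof.
move=> Qx; have [c [cc xE]] := lam_surj x; rewrite xE -(lam0 (@compact_con_bot S A)).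
apply/retic_supp_inj; rewrite !supp_lam zariski_open_bot -subset0 => p.
by apply; apply/(ideal_of_lam cc (set_valP p)); rewrite -xE; exact: (Qx (to_spec_id p)).
Qed.

Lemma lam_eq1 c (cc : compact_con c) : lam cc = \top <-> c = \top.
Proof.
split=> [c1|c1]; last by move: cc; rewrite c1; exact: lam1.
apply: contrapT => /(prime_con_above V_mod V_sd)[p pp cp].
have [_] := ideal_of_prime pp; rewrite -c1 => + _; apply.
exact/ideal_of_lam.
Qed.

Hypothesis A_reduced : forall a, commutator a a = \bot -> a = \bot.

Lemma lam_eq0 c (cc : compact_con c) : lam cc = \bot <-> c = \bot.
Proof.
split=> [c0|c0]; last by move: cc; rewrite c0; exact: lam0.
apply: contrapT => /(prime_con_missing V_mod A_K A_reduced)[p pp]; apply.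
have [[+ _ _] _ _] := ideal_of_prime pp; rewrite -c0.
by move/ideal_of_lam; apply.
Qed.

End Spectra.

Section Main.
Variables (S : signature) (V : variety S).
Hypotheses (V_mod : congruence_modular V) (V_sd : semidegenerate V).
Variables (A : member V) (A_PF : PF_algebra A) (A_K : commutator_closed A).
Local Notation L := (reticulation V_sd A_K).
Local Notation lam := (@lam S V V_sd A A_K _).

Lemma lam_disjoint a b (ca : compact_con a) (cb : compact_con b) :
  lam ca `&` lam cb = \bot <-> commutator a b = \bot :> con A.
Proof. by rewrite lamI; apply: lam_eq0 => //; exact: (PF_reduced V_mod V_sd A_PF). Qed.

(** The annihilators of disjoint classes of compact congruences are the traces
of their annihilators in the congruence lattice, whose comaximality is
witnessed by compact congruences because the total congruence is compact. *)
Lemma retic_normal : normal_lattice L.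
Proof.
move=> x y; have [a [ca ->]] := lam_surj x; have [b [cb ->]] := lam_surj y.
move=> /lam_disjoint /(PF_compact V_mod V_sd A_PF ca cb) ab1.
have [|u [v [[cu ua] [cv vb] uv]]] :=
    @compact_join_split _ _ \top (perp a) (perp b) (compact_con_top A V_sd).
  by rewrite ab1.
exists (lam cu), (lam cv); split.
- by apply/lam_disjoint; rewrite commutatorC//; apply/perpP.
- by apply/lam_disjoint; rewrite commutatorC//; apply/perpP.
- by rewrite lamU; apply/lam_eq1 => //; apply/eqP; rewrite -le1x.
Qed.

(** Complemented congruences are compact, hence seen by the reticulation, and
they are closed under meets: this takes annihilators from principal to compact
congruences. *)
Lemma PP_stone : PP_algebra A -> stone_lattice L.
Proof.
move=> A_PP x; have [a [ca ->]] := lam_surj x.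
have /complementedP -/(_ V_mod V_sd)[f [ef0 ef1]] : complemented (perp a).
  elim/compact_con_ind: a / ca.
  - by rewrite perp0//; exists \bot; rewrite meetx0 joinx0.
  - by move=> y z; apply: A_PP; exists y, z.
  - by move=> a b _ _ ? ?; rewrite perpU//; exact: complementedI.
have ec : complemented (perp a) by apply/(complementedP V_mod V_sd); exists f.
have ce := complemented_compact V_mod V_sd ec.
have fc : complemented f.
  by apply/(complementedP V_mod V_sd); exists (perp a); rewrite commutatorC// joinC.
have cf := complemented_compact V_mod V_sd fc.
exists (lam ce).
  exists (lam cf); split; first exact/lam_disjoint.
  by rewrite lamU; apply/lam_eq1.
apply/seteqP; split=> y; have [b [cb ->]] := lam_surj y.
  by move=> /lam_disjoint ab0; apply: lam_mono; apply/perpP.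
move=> /= be; apply/eqP; rewrite -lex0.
have <- : lam ca `&` lam ce = \bot by apply/lam_disjoint/perpP.
exact: leI2.
Qed.

(** If [lam c] generates the annihilator of [lam a], with complement [lam d],
then [perp a] is [c] itself and not only congruent to it: a compact [b] below
[perp a] satisfies [b = [b, c \/ d] = [b, c]]. *)
Lemma stone_PP : stone_lattice L -> PP_algebra A.
Proof.
move=> L_stone a [x [y aE]].
have ca : compact_con a by rewrite aE; exact: principal_compact.
have [e [f [ef0 ef1]] AnnE] := L_stone (lam ca).
have [c [cc eE]] := lam_surj e; have [d [cd fE]] := lam_surj f.
move: ef0 ef1; rewrite eE fE lamU => /lam_disjoint cd0 /lam_eq1 -/(_ V_mod) cd1.
have lamAnn b (cb : compact_con b) : b <= perp a <-> lam cb <= lam cc.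
  have <- : annihilator (lam ca) (lam cb) <-> lam cb <= lam cc.
    by rewrite AnnE eE.
  split=> [/perpP -/(_ V_mod)|] ab; first exact/lam_disjoint.
  by apply/perpP => //; exact/lam_disjoint.
have -> : perp a = c.
  apply: le_anti; apply/andP; split; last by apply/(lamAnn _ cc).
  apply: le_compacts => b cb /(lamAnn _ cb) bc.
  have bd0 : commutator b d = \bot.
    apply/(lam_disjoint cb cd)/eqP; rewrite -lex0.
    by rewrite -((lam_disjoint cc cd).2 cd0) leI2.
  rewrite -[b](commutator1 V_mod V_sd) -cd1 commutatorUr// bd0 joinx0.
  exact: commutator_ler.
by apply/complementedP => //; exists d.
Qed.

End Main.

Theorem theorem11p11 (S : signature) (V : variety S)
    (V_mod : congruence_modular V) (V_sd : semidegenerate V)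
    (A : member V) (A_PF : PF_algebra A) (A_K : commutator_closed A) :
  [<-> PP_algebra A;
       stone_lattice (reticulation V_sd A_K);
       has_continuous_retraction (@min_spec_id _ (reticulation V_sd A_K));
       has_continuous_retraction (@min_spec S V A);
       compact [set: set_type (@min_spec S V A)]].
Proof.
tfae.
- exact: PP_stone.
- by apply: stone_retraction; exact: retic_normal.
- apply: (@retraction_transfer _ _ (@to_spec_id S V V_sd A A_K)
    (@of_spec_id S V V_mod V_sd A A_K)).
  + exact: to_spec_id_continuous.
  + exact: of_spec_id_continuous.
  + exact: to_spec_id_min.
  + exact: of_spec_id_min.
  + exact: to_spec_idK.
- exact/retract_compact/spec_compact.
- move=> Min_compact; apply: (stone_PP V_mod A_PF).
  apply: min_compact_stone; first exact: retic_normal.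
    exact: retic_separated.
  apply: (@subspace_compact_transfer _ _ (@to_spec_id S V V_sd A A_K)
    (@of_spec_id S V V_mod V_sd A A_K)) Min_compact.
  + exact: to_spec_id_continuous.
  + exact: to_spec_id_min.
  + exact: of_spec_id_min.
  + exact: of_spec_idK.
Qed.
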